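(* Let $d\in\mathbb{N}^*$, $r\in[1,d]$, $c_*\ge 1$, $\upsilon\in[0,1]$, $\mu_1,\dots,\mu_d>0$ and $d_*=\sum_{i=1}^d\mu_i$. Consider, for $n$ large enough, the sequence model $$y_{j,\ell,\mathbf{k}}=\theta_{j,\ell,\mathbf{k}}+n^{-r/2}z_{j,\ell,\mathbf{k}},\qquad j=0,\dots,J,\ \ell\in B_j,\ \mathbf{k}\in D_j.$$ Suppose that, for any $j\in\{0,\dots,J\}$ and any $\ell\in B_j$, the variables $(z_{j,\ell,\mathbf{k}})_{\mathbf{k}}$ are i.i.d. $\mathcal{N}(0,1)$ (as is the case when the transform producing the coefficients corresponds to an orthobasis). Let $\widehat\theta^*$ be the block estimator defined in the context (which is the general block estimator taken with $\delta=0$), with $\lambda_*$ the root of $x-\log x=3$ given by $\lambda_*=4.50524\ldots$. Then, for $s>0$, $0<p\le\infty$, $0<q\le\infty$, $M\in(0,\infty)$, there exists a constant $C>0$ (independent of $n$) such that $$\sup_{\theta\in\boldsymbol{\Theta}^s_{p,q}(M)}R\left(\widehat\theta^*,\theta\right)\le C\rho_n,$$ where $$\rho_n=\begin{cases} n^{-2sr/(2s+d_*+\upsilon)}, & \text{for } q\le 2\le p,\\ (\log n/n)^{2sr/(2s+d_*+\upsilon)}, & \text{for } q\le p<2,\ sp>\max\left(d_*,(1-p/2)(d_*+\upsilon)\right).\end{cases}$$ Moreover, if $\upsilon=0$, these rates (respectively for $p\ge 2$, and for $p<2$ with $sp>\max(d_*,(1-p/2)d_* )$) hold without the restriction $q\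le\min(p,2)$.
   Context: Notation. $\log$ is the natural logarithm, $\lfloor\cdot\rfloor$ is the floor, $(x)_+=\max(x,0)$, $\mathbb{N}^*=\{1,2,\dots\}$. Index sets. $J=\lfloor\log_2 n\rfloor$. For every integer $j\ge 0$: $B_j=\{1,\dots,\lfloor c_*2^{\upsilon j}\rfloor\}$ and $D_j=\prod_{i=1}^d\{0,\dots,\lfloor 2^{\mu_i j}\rfloor-1\}$; $\mathbf{k}=(k_1,\dots,k_d)$ denotes an element of $D_j$. Blocks. $L=\lfloor(r\log n)^{1/d}\rfloor$ is the block length, $j_0=\lfloor(1/\min_{i=1,\dots,d}\mu_i)\log_2 L\rfloor$ is the coarsest scale, and $J_*=\lfloor (r/(d_*+\upsilon))\log_2 n\rfloor$. For $j\in\{j_0,\dots,J_*\}$, $\mathcal{A}_j=\prod_{i=1}^d\{1,\dots,\lfloor 2^{\mu_i j}L^{-1}\rfloor\}$ is the set of block indices at scale $j$, and for $\mathbf{K}=(K_1,\dots,K_d)\in\mathcal{A}_j$, $U_{j,\mathbf{K}}=\{\mathbf{k}\in D_j:\ (K_i-1)L\le k_i\le K_iL-1\text{ for }i=1,\dots,d\}$. Convention: rounding effects at the boundary are ignored, i.e. for $j\in\{j_0,\dots,J_*\}$ the blocks $U_{j,\mathbf{K}}$, $\mathbf{K}\in\mathcal{A}_j$, are regarded as covering $D_j$, so that $\sum_{\mathbf{k}\in D_j}$ is identified with $\sum_{\mathbf{K}\in\mathcal{A}_j}\sum_{\mathbf{k}\in U_{j,\mathbf{K}}}$. Estimator. For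 $\ell\in B_j$ and $\mathbf{k}\in D_j$ (with, when $j\in\{j_0,\dots,J_*\}$, $\mathbf{K}\in\mathcal{A}_j$ the index of the block such that $\mathbf{k}\in U_{j,\mathbf{K}}$), $$\widehat\theta^*_{j,\ell,\mathbf{k}}=\begin{cases} y_{j,\ell,\mathbf{k}}, & j\in\{0,\dots,j_0-1\},\\ y_{j,\ell,\mathbf{k}}\left(1-\dfrac{\lambda_*n^{-r}}{\frac{1}{L^d}\sum_{\mathbf{k}'\in U_{j,\mathbf{K}}}y_{j,\ell,\mathbf{k}'}^2}\right)_+, & j\in\{j_0,\dots,J_*\},\\ 0, & j\in\mathbb{N}\setminus\{0,\dots,J_*\},\end{cases}$$ with value $0$ in the second case if the block sum of squares vanishes. Risk. For a family $\theta=(\theta_{j,\ell,\mathbf{k}})_{j\ge 0,\ell\in B_j,\mathbf{k}\in D_j}$ of reals, $R(\widehat\theta,\theta)=\sum_{j=0}^\infty\sum_{\ell\in B_j}\sum_{\mathbf{k}\in D_j}\mathbb{E}\left((\widehat\theta_{j,\ell,\mathbf{k}}-\theta_{j,\ell,\mathbf{k}})^2\right)$. Smoothness space. $\boldsymbol{\Theta}^s_{p,q}(M)$ is the set of $\theta$ such that $$\left(\sum_{j=0}^\infty\sum_{\ell\in B_j}\left(2^{j(s+d_*/2-d_*/p)}\Big(\sum_{\mathbf{k}\in D_j}|\theta_{j,\ell,\mathbf{k}}|^p\Big)^{1/p}\right)^q\right)^{1/q}\le M,$$ with the usual supremum modifications if $p=\infty$ or $q=\infty$ (and $d_*/p=0$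 if $p=\infty$). *)

(* Defs.v *)
From HB Require Import structures.
From mathcomp Require Import all_boot all_order all_algebra.
From mathcomp Require Import all_classical all_reals all_analysis.

Set Implicit Arguments.
Unset Strict Implicit.
Unset Printing Implicit Defensive.

Import Order.TTheory GRing.Theory Num.Theory.
Import numFieldNormedType.Exports.

Local Open Scope classical_set_scope.
Local Open Scope ring_scope.

(* [Num.truncn] is the floor of a nonnegative real, as a natural number. *)

Section log2.
Context {R : realType}.

Definition log2 (x : R) : R := ln x / ln 2.

End log2.

(* The labels l in {1, ..., m} and the block indices K_i in {1, ..., m} are
   represented from 0, by the ordinals i < m standing for i + 1. *)
Section index_sets.
Context {R : realType} {d : nat}.
Implicit Types (cs ups r : R) (mu : 'I_d -> R) (n j : nat).

Definition dstar mu : R := \sum_(i < d) mu i.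

Definition Bsize cs ups j : nat := Num.truncn (cs * 2 `^ (ups * j%:R)).

Definition Bset cs ups j := 'I_(Bsize cs ups j).

Definition Dset mu j :=
  {dffun forall i : 'I_d, 'I_(Num.truncn (2 `^ (mu i * j%:R)))}.

Definition fineScale n : nat := Num.truncn (log2 (n%:R : R)).

Definition blockLen r n : nat := Num.truncn ((r * ln n%:R) `^ (d%:R^-1)).

Definition coarseScale r mu n : nat :=
  Num.truncn (1 / inf (range mu) * log2 ((blockLen r n)%:R)).

Definition maxScale r ups mu n : nat :=
  Num.truncn (r / (dstar mu + ups) * log2 n%:R).

Definition Aset r mu n j :=
  {dffun forall i : 'I_d,
     'I_(Num.truncn (2 `^ (mu i * j%:R) / (blockLen r n)%:R))}.

Definition block r mu n j (K : Aset r mu n j) : {set Dset mu j} :=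
  finset (fun k : Dset mu j =>
    [forall i, (K i * blockLen r n <= k i < (K i).+1 * blockLen r n)%N]).

Definition blockScales r ups mu n j : bool :=
  (coarseScale r mu n <= j <= maxScale r ups mu n)%N.

(* The sum over k in D_j; at the scales j_0 <= j <= J_* it is identified with
   the double sum over the blocks and over the positions in each block, so the
   boundary positions that the blocks leave out through rounding are ignored. *)
Definition sumD r ups mu n j (F : Dset mu j -> \bar R) : \bar R :=
  if blockScales r ups mu n j
  then (\sum_(K : Aset r mu n j) \sum_(k in block K) F k)%E
  else (\sum_(k : Dset mu j) F k)%E.

Definition coef_family (X : Type) cs ups mu :=
  forall j : nat, Bset cs ups j -> Dset mu j -> X.

End index_sets.

Section noise.
Context {disp : measure_display} {T : measurableType disp} {R : realType}.
Context (P : probability T R) {I : finType}.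

Definition mutually_independent (X : I -> {RV P >-> R}) : Prop :=
  forall (S : {set I}) (A : I -> set R),
    (forall i, i \in S -> measurable (A i)) ->
    P (\bigcap_(i in [set` S]) (X i @^-1` A i)) =
    (\prod_(i in S) P (X i @^-1` A i))%E.

Definition iid_std_normal (X : I -> {RV P >-> R}) : Prop :=
  mutually_independent X /\
  (forall i (A : set R), measurable A ->
     distribution P (X i) A = normal_prob 0 1 A).

End noise.

(* The scales that are observed, {0, ..., J}. When r > d_* + ups one has
   J_* > J for large n, and the estimator uses observations up to scale J_*;
   the model is then understood up to J_*. *)
Definition lastObserved {R : realType} {d : nat} (r ups : R) (mu : 'I_d -> R)
    (n : nat) : nat :=
  maxn (@fineScale R n) (maxScale r ups mu n).

Section estimator.
Context {R : realType} {d : nat}.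
Context (lam r cs ups : R) (mu : 'I_d -> R) (n : nat).

Definition block_mean_square j (l : Bset cs ups j) (K : Aset r mu n j)
    (y : coef_family R cs ups mu) : R :=
  1 / ((blockLen (d := d) r n)%:R ^+ d) * \sum_(k in block K) y j l k ^+ 2.

Definition shrink (m : R) : R :=
  Num.max (1 - lam * n%:R `^ (- r) / m) 0.

(* [None] occurs only at the boundary positions ignored by [sumD]. *)
Definition estimator (y : coef_family R cs ups mu) : coef_family R cs ups mu :=
  fun j l k =>
    if (j < coarseScale r mu n)%N then y j l k
    else if (j <= maxScale r ups mu n)%N then
      if [pick K : Aset r mu n j | k \in block K] is Some K then
        let m := block_mean_square l K y in
        if m == 0 then 0 else y j l k * shrink m
      else 0
    else 0.

Context {disp : measure_display} {T : measurableType disp}.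
Context (P : probability T R).

Definition observation (theta : coef_family R cs ups mu)
    (z : coef_family {RV P >-> R} cs ups mu) (w : T) : coef_family R cs ups mu :=
  fun j l k => theta j l k + n%:R `^ (- r / 2) * z j l k w.

Definition risk (z : coef_family {RV P >-> R} cs ups mu)
    (theta : coef_family R cs ups mu) : \bar R :=
  (\sum_(0 <= j <oo) \sum_(l : Bset cs ups j)
     sumD r ups n (fun k : Dset mu j =>
       'E_P[fun w => ((estimator (observation theta z w) l k
                       - theta j l k) ^+ 2)%R]))%E.

End estimator.

Section smoothness_space.
Context {R : realType} {d : nat} {cs ups : R} {mu : 'I_d -> R}.
Implicit Types (s : R) (p q : \bar R) (theta : coef_family R cs ups mu).

(* [p] ranges over ]0, +oo]; the default branch is the case p = +oo. *)
Definition lp_norm (I : finType) p (x : I -> R) : R :=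
  if p is p'%:E then (\sum_i `|x i| `^ p') `^ p'^-1
  else \big[Num.max/0]_i `|x i|.

(* [(+oo)^-1 = 0] in [\bar R]. *)
Definition level_norm s p theta j (l : Bset cs ups j) : R :=
  2 `^ (j%:R * (s + dstar mu / 2 - dstar mu * fine (p^-1)%E))
  * lp_norm p (theta j l).

Definition smoothness_norm s p q theta : \bar R :=
  if q is q'%:E then
    ((\sum_(0 <= j <oo) \sum_(l : Bset cs ups j)
        (level_norm s p theta l `^ q')%:E) `^ q'^-1)%E
  else ereal_sup [set x : \bar R |
    exists j (l : Bset cs ups j), x = (level_norm s p theta l)%:E].

Definition smoothness_ball s p q (M : R) : set (coef_family R cs ups mu) :=
  [set theta | (smoothness_norm s p q theta <= M%:E)%E].

End smoothness_space.

Section rates.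
Context {R : realType} {d : nat} (s r ups : R) (mu : 'I_d -> R) (n : nat).

Definition rate : R :=
  n%:R `^ (- (2 * s * r / (2 * s + dstar mu + ups))).

Definition rate_log : R :=
  (ln n%:R / n%:R) `^ (2 * s * r / (2 * s + dstar mu + ups)).

End rates.

(* Main.v *)
Require Import Defs.
From HB Require Import structures.
From mathcomp Require Import all_boot all_order all_algebra.
From mathcomp Require Import all_classical all_reals all_analysis.
From mathcomp Require Import measurable_realfun finmap ring lra.

Set Implicit Arguments.
Unset Strict Implicit.
Unset Printing Implicit Defensive.

Import Order.TTheory GRing.Theory Num.Theory.
Import numFieldNormedType.Exports.

Local Open Scope classical_set_scope.
Local Open Scope ring_scope.

(* A block of size m = L^d is shrunk by a map that is 2-Lipschitz, so its loss
   is at most a multiple of |theta|^2 plus the excess of the noise energy over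
   the threshold lam m n^-r; it is also at most a multiple of m n^-r.
   Chernoff's bound at t = (1 - 1/lam)/2, where E exp(t z^2) = sqrt lam, bounds
   the mean excess of a chi-square with m degrees of freedom over lam m by
   e^-m / t: this is exactly what the equation lam - ln lam = 3 provides.  Hence
   each block costs min(|theta|^2, m n^-r) + n^-r e^-m up to constants.
   Summing, with a = d_* + ups, the minima decay geometrically on both sides of
   the scale where 2^(j a) eta meets eta^(1-p/2) 2^(-j (sp - (1-p/2) a)), with
   eta = n^-r for p >= 2 and eta = m n^-r for p < 2, and they add up to
   eta^(2s/(2s+a)).  The coarse scales, the e^-m terms and the energy beyond
   J_* are of order n^(-2sr/(2s+a)). *)

(** For p >= 2 the minima are bounded by the plain energy of the level, so the block size never
    meets the signal. For p < 2 each minimum is bounded by (m n^-r)^(1 - p/2) times the sum of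
    |theta|^p over the block, and m, of order log n, stays in the rate. The two lower bounds on sp
    have different roles: sp > (1 - p/2) a makes the truncated energies decay past the crossing
    scale, and combined with sp > d_* it makes the energy beyond J_* small enough. The relation
    between q and min(p, 2) serves to sum powers of the level norms over B_j; for ups = 0 that set
    has at most c_* elements, and a bound on each level norm is enough. Since L is a floor, L^d may
    fall short of r log n and e^-m may exceed n^-r; the target exponent is the fraction 2s/(2s + a)
    < 1 of r, which leaves room for this and for the powers of log n of the coarse scales.
    Independence is given for events, so the product formula for expectations is derived from it by
    induction on the factors. *)

(** * Integration against a weighted image measure *)

Section density.
Local Open Scope ereal_scope.
Context d1 d2 (T : measurableType d1) (S : measurableType d2) (R : realType).
Variables (mu : {measure set T -> \bar R}) (nu : {measure set S -> \bar R}).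
Variables (h : T -> R) (Y : T -> S) (c : R).
Hypothesis h_ge0 : forall w, (0 <= h w)%R.
Hypothesis mh : measurable_fun setT h.
Hypothesis mY : measurable_fun setT Y.
Hypothesis hY : forall B, measurable B ->
  \int[mu]_w (h w * \1_B (Y w))%:E = c%:E * nu B.

Import HBNNSimple.

Let measurable_indic_comp B : measurable B ->
  measurable_fun setT (fun w => \1_B (Y w) : R).
Proof.
move=> mB; rewrite (_ : (fun w => _) = \1_(Y @^-1` B))//.
by apply: measurable_indic; rewrite -[X in measurable X]setTI; exact: mY.
Qed.

Let density_nnsfun (g : {nnsfun S >-> R}) :
  \int[mu]_w (h w * g (Y w))%:E = c%:E * \int[nu]_y (g y)%:E.
Proof.
pose s := fset_set (g @` setT).
have s_ge0 (i : 'I_(#|` s|)) : (0 <= s`_i)%R.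
  have : s`_i \in s by apply: mem_nth.
  by rewrite in_fset_set// in_setE => -[x _ <-].
have mg i : measurable (g @^-1` [set s`_i]) by exact: measurable_funPTI.
under eq_integral => w _.
  rewrite (fimfunEord g) mulr_sumr -sumEFin.
  under eq_bigr do rewrite mulrCA EFinM.
  over.
rewrite ge0_integral_sum//; last first.
- by move=> i w _; rewrite mule_ge0 ?lee_fin ?mulr_ge0.
- move=> i; apply/measurable_EFinP/measurable_funM => //.
  apply: measurable_funM => //; exact: measurable_indic_comp.
under [in RHS]eq_integral => y _.
  rewrite (fimfunEord g) -sumEFin.
  under eq_bigr do rewrite EFinM.
  over.
rewrite ge0_integral_sum//; last first.
- by move=> i w _; rewrite mule_ge0 ?lee_fin.
- move=> i; apply/measurable_EFinP/measurable_funM => //.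
rewrite ge0_sume_distrr; last first.
  by move=> i _; apply: integral_ge0 => y _; rewrite mule_ge0 ?lee_fin.
apply: eq_bigr => i _.
rewrite ge0_integralZl_EFin//; last 2 first.
- by move=> w _; rewrite lee_fin mulr_ge0.
- apply/measurable_EFinP/measurable_funM => //; exact: measurable_indic_comp.
rewrite hY// ge0_integralZl_EFin//; last first.
  by apply/measurable_EFinP; exact: measurable_indic.
by rewrite integral_indic// setIT muleCA.
Qed.

(** Agreement on indicators extends to simple functions by linearity and to [f] by monotone
    convergence. Two instances matter: Lebesgue measure with a Gaussian density as [h], and a
    probability with the product of the remaining independent factors as [h]. *)
Lemma ge0_integral_density (f : S -> R) : measurable_fun setT f ->
  (forall y, 0 <= f y)%R ->
  \int[mu]_w (h w * f (Y w))%:E = c%:E * \int[nu]_y (f y)%:E.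
Proof.
move=> mf f0.
have mf' : measurable_fun setT (EFin \o f) by exact/measurable_EFinP.
pose g := nnsfun_approx measurableT mf'.
have g_cvg y : EFin \o g^~ y @ \oo --> (f y)%:E.
  by apply: (cvg_nnsfun_approx measurableT mf') => // x _; rewrite lee_fin.
have g_nd y m n : (m <= n)%N -> (g m y <= g n y)%R.
  by move=> mn; have /lefP := nd_nnsfun_approx measurableT mf' mn; exact.
have cvg1 : \int[nu]_y (g n y)%:E @[n --> \oo] --> \int[nu]_y (f y)%:E.
  have -> : (fun y => (f y)%:E) = (fun y => limn (fun n => (g n y)%:E)).
    by apply/funext => y; apply/esym/cvg_lim => //; exact: g_cvg.
  apply: cvg_monotone_convergence => //.
  - by move=> n; apply/measurable_EFinP.
  - by move=> n x _; rewrite lee_fin.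
  - by move=> x _ m n mn; rewrite lee_fin g_nd.
have cvg2 : \int[mu]_w (h w * g n (Y w))%:E @[n --> \oo] -->
    \int[mu]_w (h w * f (Y w))%:E.
  have -> : (fun w => (h w * f (Y w))%:E) =
      (fun w => limn (fun n => (h w * g n (Y w))%:E)).
    apply/funext => w; apply/esym/cvg_lim => //.
    under eq_fun do rewrite EFinM.
    by rewrite EFinM; apply: cvgeZl => //; exact: g_cvg.
  apply: cvg_monotone_convergence => //.
  - move=> n; apply/measurable_EFinP/measurable_funM => //.
    exact: measurableT_comp.
  - by move=> n x _; rewrite lee_fin mulr_ge0.
  - by move=> x _ m n mn; rewrite lee_fin ler_wpM2l ?g_nd.
apply: (cvg_unique _ cvg2) => //=.
rewrite (_ : (fun n => _) = fun n => c%:E * \int[nu]_y (g n y)%:E).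
  exact: cvgeZl.
by apply/funext => n; rewrite (density_nnsfun (g n)).
Qed.

End density.

(** * The exponential moment of a squared Gaussian *)

Section gaussian_moments.
Context {R : realType}.

(** Since 1/2 - (1 - 1/lam)/2 = 1/(2 lam), the integrand times the standard density is sqrt lam
    times the centred Gaussian density of variance lam, which has mass 1. *)
Lemma integral_expR_sqr_normal_prob (nu : {measure set R -> \bar R}) (lam : R) :
  0 < lam -> (forall A, measurable A -> nu A = normal_prob 0 1 A) ->
  (\int[nu]_x (expR ((1 - lam^-1) / 2 * x ^+ 2))%:E = (Num.sqrt lam)%:E)%E.
Proof.
move=> lam0 nuE.
have mexp : measurable_fun setT (fun x : R => expR ((1 - lam^-1) / 2 * x ^+ 2)).
  apply: measurableT_comp => //; apply: measurable_funM => //.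
rewrite -[LHS]mul1e -(@ge0_integral_density _ _ _ _ _ (@lebesgue_measure R)
  nu (normal_pdf 0 1) id 1 _ _ _ _ _ mexp)//; first last.
- move=> B mB; rewrite mul1e nuE// /normal_prob [RHS]integral_mkcond/=.
  apply: eq_integral => x _.
  by rewrite patchE indicE; case: (x \in B); rewrite ?mulr1 ?mulr0.
- exact: measurable_normal_pdf.
- by move=> x; exact: normal_pdf_ge0.
have sl0 : Num.sqrt lam != 0 by rewrite gt_eqF ?sqrtr_gt0.
under eq_integral => x _.
  rewrite (_ : _ * _ = Num.sqrt lam * normal_pdf 0 (Num.sqrt lam) x); last first.
    rewrite !normal_pdfE ?oner_eq0// /normal_peak /normal_fun subr0.
    rewrite sqr_sqrtr ?(ltW lam0)// expr1n mul1r -[LHS]mulrA -expRD.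
    rewrite -[lam * pi *+ 2]mulrnAr sqrtrM ?(ltW lam0)// invfM !mulrA divff// mul1r.
    congr (_ * expR _); rewrite -mulr_natr; field; lra.
  rewrite EFinM.
  over.
rewrite ge0_integralZl_EFin//=.
- by rewrite integral_normal_pdf mule1.
- by move=> x _; rewrite lee_fin normal_pdf_ge0.
- by apply/measurable_EFinP; exact: measurable_normal_pdf.
Qed.

End gaussian_moments.

(** * Measurability of finite sums and products *)

Section measurable_bigop.
Context {disp : measure_display} {T : measurableType disp} {R : realType}.
Context {I : finType} (S : {set I}) (h : I -> T -> R).
Hypothesis mh : forall i, measurable_fun setT (h i).

Lemma measurable_sum_set : measurable_fun setT (fun w => \sum_(i in S) h i w).
Proof.
rewrite (_ : (fun w => _) = fun w => \sum_(i <- enum S) h i w).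
  exact: measurable_sum.
by apply/funext => w; rewrite big_enum.
Qed.

Lemma measurable_prod_set : measurable_fun setT (fun w => \prod_(i in S) h i w).
Proof.
rewrite (_ : (fun w => _) = fun w => \prod_(i <- enum S) h i w).
  by apply: measurable_prod => i _; exact: mh.
by apply/funext => w; rewrite big_enum.
Qed.

End measurable_bigop.

(** * The product formula for independent variables *)

Section independence.
Context {disp : measure_display} {T : measurableType disp} {R : realType}.
Context (P : probability T R) {I : finType}.
Implicit Type X : I -> {RV P >-> R}.

(** The indicator over [U] is what makes the induction work. For a head index i, the induction
    hypothesis at [i |: U] gives the density relation on events of X i, and [ge0_integral_density]
    passes from these events to f(X i). *)
Lemma integral_prod_indicator X (f : R -> R) (e : R) :
  mutually_independent X -> measurable_fun setT f -> (forall x, 0 <= f x) ->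
  (forall i, (\int[P]_w (f (X i w))%:E = e%:E)%E) ->
  forall (s : seq I) (U : {set I}) (A : I -> set R), uniq s ->
    {in s, forall i, i \notin U} -> (forall i, measurable (A i)) ->
  (\int[P]_w (\prod_(i <- s) f (X i w) *
      \1_(\bigcap_(i in [set` U]) (X i @^-1` A i)) w)%:E =
   (e ^+ size s * \prod_(i in U) fine (P (X i @^-1` A i)))%:E)%E.
Proof.
move=> indX mf f0 intf; elim=> [|i s IH] U A /=.
  move=> _ _ mA; under eq_integral do rewrite big_nil mul1r.
  have mXA i : measurable (X i @^-1` A i) by exact: measurable_funPTI.
  rewrite integral_indic ?setIT//; last by apply: fin_bigcap_measurable.
  apply: etrans (indX U A _) _; first by move=> i _; exact: mA.
  rewrite expr0 mul1r -prodEFin; apply: eq_bigr => i _.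
  by rewrite fineK// fin_num_measure.
move=> /andP[iNs us] disj mA.
have iU : i \notin U by apply: disj; rewrite mem_head.
have sU : {in s, forall k, k \notin U}.
  by move=> k ks; apply: disj; rewrite inE ks orbT.
have mXA k : measurable (X k @^-1` A k) by exact: measurable_funPTI.
pose h w := \prod_(k <- s) f (X k w) *
  \1_(\bigcap_(k in [set` U]) (X k @^-1` A k)) w.
under eq_integral => w _.
  rewrite big_cons (_ : _ * _ = h w * f (X i w)); last by rewrite /h; ring.
  over.
rewrite (@ge0_integral_density _ _ _ _ _ P (distribution P (X i)) h (X i)
  (e ^+ size s * \prod_(k in U) fine (P (X k @^-1` A k))))//.
- rewrite ge0_integral_distribution//; last exact/measurable_EFinP.
  by rewrite /= intf -EFinM; congr (_%:E); rewrite exprS; ring.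
- by move=> w; rewrite mulr_ge0// prodr_ge0.
- apply: measurable_funM.
    by apply: measurable_prod => k _; apply: measurableT_comp.
  by apply: measurable_indic; apply: fin_bigcap_measurable.
- move=> B mB.
  pose A' k := if k == i then B else A k.
  have := IH (i |: U) A' us; rewrite big_setU1//= => IH'.
  rewrite (_ : distribution P (X i) B = (fine (P (X i @^-1` B)))%:E); last first.
    by rewrite fineK// fin_num_measure//; exact: measurable_funPTI.
  rewrite -EFinM (_ : _ * _ * fine _ = e ^+ size s * (fine (P (X i @^-1` A' i)) *
      \prod_(k in U) fine (P (X k @^-1` A' k)))); last first.
    rewrite {1}/A' eqxx -mulrA [_ * fine _]mulrC; congr (_ * (_ * _)).
    apply: eq_bigr => k kU; rewrite /A'; case: eqP => // ki.
    by move: iU; rewrite -ki kU.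
  rewrite -IH'.
  + apply: eq_integral => w _; congr (_%:E); rewrite /h -mulrA; congr (_ * _).
    rewrite !indicE -natrM mulnb; congr (_%:R); congr nat_of_bool.
    apply/idP/idP.
    * move=> /andP[/set_mem Uw /set_mem Bw]; apply/mem_set => k /=.
      rewrite in_setU1 /A' => /orP[/eqP ->|kU]; first by rewrite eqxx.
      by case: eqP => [->//|_]; exact: Uw.
    * move=> /set_mem Uw; apply/andP; split; apply/mem_set.
        move=> k /= kU; have /= := Uw k; rewrite in_setU1 kU orbT /A'.
        by case: eqP => [ki|_ ]; [move: iU; rewrite -ki kU|exact].
      by have /= := Uw i; rewrite in_setU1 eqxx /A' eqxx; exact.
  + move=> k ks; rewrite in_setU1 negb_or sU// andbT.
    by apply: contraNneq iNs => <-.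
  + by move=> k; rewrite /A'; case: ifP.
Qed.

Lemma integral_prod_independent X (f : R -> R) (e : R) (S : {set I}) :
  mutually_independent X -> measurable_fun setT f -> (forall x, 0 <= f x) ->
  (forall i, (\int[P]_w (f (X i w))%:E = e%:E)%E) ->
  (\int[P]_w (\prod_(i in S) f (X i w))%:E = (e ^+ #|S|)%:E)%E.
Proof.
move=> indX mf f0 intf.
have := @integral_prod_indicator X f e indX mf f0 intf (enum S) finset.set0
  (fun=> setT) (enum_uniq _).
rewrite big_set0 mulr1 -cardE => <- //.
- apply: eq_integral => w _; rewrite big_enum/=.
  by rewrite indicE mem_set ?mulr1// => i /=; rewrite inE.
- by move=> i _; rewrite inE.
Qed.

End independence.

(** * Second moment and excess of the noise energy *)

Section chi_square.
Context {disp : measure_display} {T : measurableType disp} {R : realType}.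
Context (P : probability T R) {I : finType} (z : I -> {RV P >-> R}) (lam : R).
Hypothesis iid_z : iid_std_normal z.
Hypothesis lam_gt1 : 1 < lam.
Hypothesis lam_root : lam - ln lam = 3.

Let t := (1 - lam^-1) / 2.

Let t_gt0 : 0 < t.
Proof. by rewrite divr_gt0// subr_gt0 invf_lt1// (lt_trans _ lam_gt1). Qed.

Let mexp : measurable_fun setT (fun x : R => expR (t * x ^+ 2)).
Proof. by apply: measurableT_comp => //; apply: measurable_funM. Qed.

Let exp_moment i : (\int[P]_w (expR (t * z i w ^+ 2))%:E = (Num.sqrt lam)%:E)%E.
Proof.
rewrite -(integral_expR_sqr_normal_prob (nu := distribution P (z i)) _ (iid_z.2 i)).
  by rewrite ge0_integral_distribution//; exact/measurable_EFinP.
by rewrite (lt_trans _ lam_gt1).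
Qed.

(** Only the order of the noise energy matters, so t x^2 <= exp(t x^2) suffices and reuses the
    exponential moment. *)
Lemma integral_sqr_le i : (\int[P]_w (z i w ^+ 2)%:E <= (t^-1 * Num.sqrt lam)%:E)%E.
Proof.
rewrite EFinM -(exp_moment i) -ge0_integralZl_EFin//; last 2 first.
- apply/measurable_EFinP; exact: (measurableT_comp mexp).
- by rewrite invr_ge0 ltW.
apply: ge0_le_integral => //.
- by move=> w _; rewrite lee_fin sqr_ge0.
- by apply/measurable_EFinP; apply: measurable_funX.
- apply/measurable_EFinP; apply: measurable_funM => //.
  exact: (measurableT_comp mexp).
- move=> w _; rewrite lee_fin ler_pdivlMl// (le_trans _ (expR_ge1Dx _))//.
  by rewrite lerDr.
Qed.

Lemma chi_square_excess (S : {set I}) :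
  (\int[P]_w (Num.max (\sum_(i in S) z i w ^+ 2 - lam * #|S|%:R) 0)%:E
     <= (t^-1 * expR (- #|S|%:R))%:E)%E.
Proof.
have lam0 : 0 < lam by rewrite (lt_trans _ lam_gt1).
have mS : measurable_fun setT (fun w => \sum_(i in S) z i w ^+ 2).
  by apply: measurable_sum_set => i; apply: measurable_funX.
(* With t lam = (lam - 1)/2, the exponent per coordinate is (ln lam - lam + 1)/2, which the root
   equation makes equal to -1. *)
have -> : expR (- #|S|%:R) =
    expR (- (t * lam * #|S|%:R)) * Num.sqrt lam ^+ #|S|.
  rewrite -[Num.sqrt lam]lnK ?posrE ?sqrtr_gt0// -expRM_natl -expRD; congr expR.
  rewrite -powR12_sqrt ?(ltW lam0)// ln_powR /t.
  have -> : ln lam = lam - 3 by move: lam_root; lra.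
  by field; rewrite gt_eqF.
have -> : (t^-1 * (expR (- (t * lam * #|S|%:R)) * Num.sqrt lam ^+ #|S|))%:E =
    (\int[P]_w ((t^-1 * expR (- (t * lam * #|S|%:R)))%:E *
       (\prod_(i in S) expR (t * z i w ^+ 2))%:E))%E.
  rewrite ge0_integralZl_EFin//.
  - rewrite (integral_prod_independent S (f := fun x => expR (t * x ^+ 2)) iid_z.1 mexp _ exp_moment).
      by rewrite -EFinM mulrA.
    by move=> x; exact: expR_ge0.
  - by move=> w _; rewrite lee_fin prodr_ge0// => i _; exact: expR_ge0.
  - apply/measurable_EFinP; apply: measurable_prod_set => i.
    exact: (measurableT_comp mexp).
  - by rewrite mulr_ge0 ?invr_ge0 ?expR_ge0// ltW.
apply: ge0_le_integral => //.
- by move=> w _; rewrite lee_fin le_max lexx orbT.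
- apply/measurable_EFinP; apply: measurable_maxr => //.
  exact: measurable_funB.
- apply/measurable_EFinP; apply: measurable_funM => //.
  apply: measurable_prod_set => i; exact: (measurableT_comp mexp).
- move=> w _; rewrite -EFinM lee_fin -[leRHS]mulrA.
  rewrite ler_pdivlMl//.
  rewrite -expR_sum -expRD maxr_pMr ?(ltW t_gt0)// mulr0 ge_max expR_ge0 andbT.
  rewrite -mulr_sumr [- _ + _]addrC -(mulrA t) -mulrBr.
  by rewrite (le_trans _ (expR_ge1Dx _))// lerDr.
Qed.

End chi_square.

(** * Deterministic loss of block shrinkage *)

Section shrinkage.
Context {R : realType} {I : finType} (S : {set I}).
Implicit Types (x y w theta : I -> R) (tau : R).

Lemma sqrt_sum_sqr_triangle x y :
  Num.sqrt (\sum_(i in S) (x i + y i) ^+ 2) <=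
  Num.sqrt (\sum_(i in S) x i ^+ 2) + Num.sqrt (\sum_(i in S) y i ^+ 2).
Proof.
set A := \sum_(i in S) x i ^+ 2; set B := \sum_(i in S) y i ^+ 2.
have A0 : 0 <= A by apply: sumr_ge0 => i _; exact: sqr_ge0.
have B0 : 0 <= B by apply: sumr_ge0 => i _; exact: sqr_ge0.
set a := Num.sqrt A; set b := Num.sqrt B.
have aE : a ^+ 2 = A by rewrite sqr_sqrtr.
have bE : b ^+ 2 = B by rewrite sqr_sqrtr.
have a0 : 0 <= a by exact: sqrtr_ge0.
have b0 : 0 <= b by exact: sqrtr_ge0.
set C := \sum_(i in S) x i * y i.
have -> : \sum_(i in S) (x i + y i) ^+ 2 = A + 2 * C + B.
  rewrite mulr_sumr -!big_split/=; apply: eq_bigr => i _; ring.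
have CS : C <= a * b.
  (* This sum equals 2ab(ab - C), hence C <= ab when ab > 0. If ab = 0, one of the two families
     vanishes on S and C = 0. *)
  have : 0 <= \sum_(i in S) (b * x i - a * y i) ^+ 2.
    by apply: sumr_ge0 => i _; exact: sqr_ge0.
  have -> : \sum_(i in S) (b * x i - a * y i) ^+ 2 =
      b ^+ 2 * A - 2 * (a * b) * C + a ^+ 2 * B.
    rewrite !mulr_sumr -sumrN -!big_split/=; apply: eq_bigr => i _; ring.
  rewrite -aE -bE => H.
  have : 0 <= (a * b) * (a * b - C) by move: H; nra.
  have [ab0|] := ltrP 0 (a * b); first by rewrite pmulr_rge0// subr_ge0.
  rewrite le_eqVlt ltNge mulr_ge0// orbF mulf_eq0 => /orP[] /eqP e0 _.
  - rewrite e0 mul0r /C big1// => i iS.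
    have : \sum_(i in S) x i ^+ 2 == 0 by rewrite -/A -aE e0 expr0n.
    rewrite psumr_eq0; last by move=> k _; exact: sqr_ge0.
    by move=> /allP/(_ i (mem_index_enum _)); rewrite iS/= sqrf_eq0 => /eqP ->; rewrite mul0r.
  - rewrite e0 mulr0 /C big1// => i iS.
    have : \sum_(i in S) y i ^+ 2 == 0 by rewrite -/B -bE e0 expr0n.
    rewrite psumr_eq0; last by move=> k _; exact: sqr_ge0.
    by move=> /allP/(_ i (mem_index_enum _)); rewrite iS/= sqrf_eq0 => /eqP ->; rewrite mulr0.
rewrite -(ler_pXn2r (ltn0Sn 1)) ?nnegrE ?sqrtr_ge0 ?addr_ge0//.
rewrite sqr_sqrtr; first by rewrite sqrrD aE bE; lra.
rewrite -aE -bE; have : 0 <= \sum_(i in S) (x i + y i) ^+ 2.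
  by apply: sumr_ge0 => i _; exact: sqr_ge0.
suff -> : \sum_(i in S) (x i + y i) ^+ 2 = A + 2 * C + B by rewrite aE bE.
rewrite mulr_sumr -!big_split/=; apply: eq_bigr => i _; ring.
Qed.

(** [Q] is the block sum of squares and [tau] the threshold for that sum, so the normalisation by
    L^d is absorbed in [tau]. A block of norm N > 0 is mapped to one of norm max(N - tau/N, 0). *)
Definition shrink_factor tau (Q : R) : R :=
  if Q == 0 then 0 else Num.max (1 - tau / Q) 0.

(* [x |-> x - tau / x] is 2-Lipschitz where it is nonnegative. *)
Lemma shrink_factor_sqr_le tau (N a b : R) :
  0 < tau -> 0 <= N -> 0 <= a -> 0 <= b -> N <= a + b ->
  (shrink_factor tau (N ^+ 2) * N) ^+ 2 <=
  8 * a ^+ 2 + 2 * Num.max (b ^+ 2 - tau) 0.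
Proof.
move=> tau0 N0 a0 b0 Nab.
have M0 : 0 <= Num.max (b ^+ 2 - tau) 0 by rewrite le_max lexx orbT.
have rhs0 : 0 <= 8 * a ^+ 2 + 2 * Num.max (b ^+ 2 - tau) 0.
  by rewrite addr_ge0// mulr_ge0// sqr_ge0.
rewrite /shrink_factor sqrf_eq0; case: eqP => [_|/eqP Nn0].
  by rewrite mul0r expr0n.
have Np : 0 < N by rewrite lt_neqAle eq_sym Nn0.
have [small|big] := lerP (1 - tau / N ^+ 2) 0; first by rewrite mul0r expr0n.
have tauN : tau < N ^+ 2.
  by move: big; rewrite subr_gt0 ltr_pdivrMr ?exprn_gt0// mul1r.
have -> : (1 - tau / N ^+ 2) * N = N - tau / N by field.
set u := tau / N.
have uE : u * N = tau by rewrite /u; field.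
have u0 : 0 < u by rewrite divr_gt0.
have uN : u < N by rewrite /u ltr_pdivrMr// -expr2.
(* Noise below the threshold t = sqrt tau leaves no excess, so [a] alone pays: N - t <= a and N + t
   <= 2N give (N - u) N = N^2 - t^2 <= 2aN. *)
have [btau|btau] := lerP (b ^+ 2) tau.
  have t2 : Num.sqrt tau ^+ 2 = tau by rewrite sqr_sqrtr// ltW.
  set t := Num.sqrt tau in t2.
  have t0 : 0 < t by rewrite sqrtr_gt0.
  have bt : b <= t by rewrite -(ler_pXn2r (ltn0Sn 1)) ?nnegrE ?(ltW t0)// t2.
  have ut : u <= t.
    rewrite leNgt; apply/negP => tu; have : t * t < u * N.
      by rewrite ltr_pM ?(ltW t0)// (lt_trans tu).
    by rewrite uE -t2 expr2 ltxx.
  have tN : t < N by rewrite -(ltr_pXn2r (ltn0Sn 1)) ?nnegrE ?(ltW t0)// t2.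
  have h1 : N - u <= 2 * a.
    have : (N - u) * N <= 2 * a * N.
      have : N ^+ 2 - t ^+ 2 <= 2 * a * N by nra.
      by rewrite t2 mulrBl uE expr2.
    by rewrite ler_pM2r.
  apply: (@le_trans _ _ ((2 * a) ^+ 2)); last by nra.
  by rewrite ler_pXn2r// ?nnegrE ?mulr_ge0// subr_ge0 ltW.
have bp : 0 < b by rewrite lt_neqAle b0 andbT; apply/eqP => b00; move: btau; rewrite -b00 expr0n/=; lra.
set v := tau / b.
have vE : v * b = tau by rewrite /v; field; rewrite gt_eqF.
have v0 : 0 < v by rewrite divr_gt0.
have vb : v < b by rewrite /v ltr_pdivrMr// -expr2.
(* Both N and b now exceed sqrt tau. If N <= b, monotonicity suffices; otherwise v - u <= N - b <=
   a. *)
have h1 : N - u <= 2 * a + (b - v).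
  have [Nb|bN] := lerP N b.
    have : v <= u by rewrite /v /u ler_pM2l// lef_pV2.
    lra.
  have : u + (N - b) >= v; last by lra.
  have : (u + (N - b)) * b >= v * b; last by rewrite ler_pM2r.
  rewrite vE -uE mulrDl -subr_ge0.
  have -> : u * b + (N - b) * b - u * N = (N - b) * (b - u) by ring.
  rewrite mulr_ge0 ?subr_ge0 ?(ltW bN)// (le_trans _ (ltW vb))//.
  by rewrite /u /v ler_pM2l// lef_pV2// ltW.
have h2 : (N - u) ^+ 2 <= (2 * a + (b - v)) ^+ 2.
  by rewrite ler_pXn2r// ?nnegrE ?subr_ge0 ?(ltW uN)// addr_ge0 ?mulr_ge0// subr_ge0 ltW.
(* As vb = tau and v < b, (b - v)^2 = b^2 - 2 tau + v^2 <= b^2 - tau. *)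
apply: (le_trans h2); have h3 : (b - v) ^+ 2 <= b ^+ 2 - tau.
  rewrite sqrrB -vE; nra.
have h4 : (2 * a + (b - v)) ^+ 2 <= 8 * a ^+ 2 + 2 * (b - v) ^+ 2.
  rewrite -subr_ge0.
  have -> : 8 * a ^+ 2 + 2 * (b - v) ^+ 2 - (2 * a + (b - v)) ^+ 2 =
    (2 * a - (b - v)) ^+ 2 by ring.
  exact: sqr_ge0.
have : b ^+ 2 - tau <= Num.max (b ^+ 2 - tau) 0 by rewrite le_max lexx.
lra.
Qed.

(** The shrunk observation and theta are bounded separately, by (yf - theta)^2 <= 2 (yf)^2 + 2
    theta^2. The sum of (yf)^2 is the squared norm of the shrunk block, whence 18 = 2 * 8 + 2 and 4
    = 2 * 2. *)
Lemma shrinkage_loss_le_signal tau theta w : 0 < tau ->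
  \sum_(i in S) ((theta i + w i) *
      shrink_factor tau (\sum_(k in S) (theta k + w k) ^+ 2) - theta i) ^+ 2 <=
  18 * \sum_(i in S) theta i ^+ 2
  + 4 * Num.max (\sum_(i in S) w i ^+ 2 - tau) 0.
Proof.
move=> tau0; set Q := \sum_(k in S) (theta k + w k) ^+ 2.
have nn x : 0 <= \sum_(i in S) x i ^+ 2.
  by apply: sumr_ge0 => i _; exact: sqr_ge0.
set f := shrink_factor tau Q.
have := @shrink_factor_sqr_le tau (Num.sqrt Q) _ _ tau0 (sqrtr_ge0 _)
  (sqrtr_ge0 _) (sqrtr_ge0 _) (sqrt_sum_sqr_triangle theta w).
rewrite exprMn !sqr_sqrtr ?nn// -/f => H.
apply: (@le_trans _ _ (2 * (f ^+ 2 * Q) + 2 * \sum_(i in S) theta i ^+ 2)).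
  rewrite /Q !mulr_sumr -big_split/=; apply: ler_sum => i _.
  rewrite -subr_ge0; set y := theta i + w i.
  have -> : 2 * (f ^+ 2 * y ^+ 2) + 2 * theta i ^+ 2 - (y * f - theta i) ^+ 2 =
    (y * f + theta i) ^+ 2 by ring.
  exact: sqr_ge0.
lra.
Qed.

(** Shrinking displaces a block by at most sqrt tau in norm: (1 - f)^2 Q is Q <= tau when the block
    is killed and tau^2/Q < tau otherwise. The rest of yf - theta = w - (1 - f) y is noise. *)
Lemma shrinkage_loss_le_noise tau theta w : 0 < tau ->
  \sum_(i in S) ((theta i + w i) *
      shrink_factor tau (\sum_(k in S) (theta k + w k) ^+ 2) - theta i) ^+ 2 <=
  2 * tau + 2 * \sum_(i in S) w i ^+ 2.
Proof.
move=> tau0; set Q := \sum_(k in S) (theta k + w k) ^+ 2.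
have Q0 : 0 <= Q by apply: sumr_ge0 => i _; exact: sqr_ge0.
set f := shrink_factor tau Q.
have H : (1 - f) ^+ 2 * Q <= tau.
  rewrite /f /shrink_factor; case: eqP => [->|/eqP Qn0].
    by rewrite mulr0 ltW.
  have Qp : 0 < Q by rewrite lt_neqAle eq_sym Qn0.
  have [small|big] := lerP (1 - tau / Q) 0.
    by rewrite subr0 expr1n mul1r; move: small; rewrite subr_le0 ler_pdivlMr// mul1r.
  have -> : (1 - (1 - tau / Q)) ^+ 2 * Q = tau / Q * tau by field.
  by rewrite ler_piMl ?(ltW tau0)// ltW// -subr_gt0.
apply: (@le_trans _ _ (2 * ((1 - f) ^+ 2 * Q) + 2 * \sum_(i in S) w i ^+ 2)).
  rewrite /Q !mulr_sumr -big_split/=; apply: ler_sum => i _.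
  rewrite -subr_ge0.
  have -> : 2 * ((1 - f) ^+ 2 * (theta i + w i) ^+ 2) + 2 * w i ^+ 2 -
    ((theta i + w i) * f - theta i) ^+ 2 =
    ((1 - f) * (theta i + w i) + w i) ^+ 2 by ring.
  exact: sqr_ge0.
lra.
Qed.

End shrinkage.

(** * Expected loss on one block *)

Section block_risk.
Context {disp : measure_display} {T : measurableType disp} {R : realType}.
Context (P : probability T R) {I : finType} (z : I -> {RV P >-> R}).
Context (lam eps : R) (theta : I -> R) (S : {set I}).
Hypothesis iid_z : iid_std_normal z.
Hypothesis lam_gt1 : 1 < lam.
Hypothesis lam_root : lam - ln lam = 3.
Hypothesis eps_gt0 : 0 < eps.

Let t := (1 - lam^-1) / 2.
Let m : R := #|S|%:R.
Let y k w := theta k + eps * z k w.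
Let tau := lam * (m * eps ^+ 2).
Let loss k w := (y k w * shrink_factor tau (\sum_(i in S) y i w ^+ 2) - theta k) ^+ 2.

Let t_gt0 : 0 < t.
Proof. by rewrite divr_gt0// subr_gt0 invf_lt1// (lt_trans _ lam_gt1). Qed.

Let my k : measurable_fun setT (y k).
Proof. by apply: measurable_funD => //; apply: measurable_funM. Qed.

Let mloss k : measurable_fun setT (loss k).
Proof.
apply: measurable_funX; apply: measurable_funB => //; apply: measurable_funM => //.
have mQ : measurable_fun setT (fun w => \sum_(i in S) y i w ^+ 2).
  by apply: measurable_sum_set => i; exact: measurable_funX.
rewrite /shrink_factor; apply: measurable_fun_ifT => //.
  exact: measurable_fun_eqr.
apply: measurable_maxr => //; apply: measurable_funB => //.
apply: measurable_funM => //.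
rewrite (_ : (fun w => _) = (@powR R ^~ (-1)) \o fun w => \sum_(i in S) y i w ^+ 2).
  exact: measurableT_comp.
apply/funext => w /=; rewrite powR_inv1// sumr_ge0// => i _; exact: sqr_ge0.
Qed.

Let mz2 k : measurable_fun setT (fun w => z k w ^+ 2).
Proof. exact: measurable_funX. Qed.

Let mz2sum : measurable_fun setT (fun w => \sum_(i in S) z i w ^+ 2).
Proof. exact: measurable_sum_set. Qed.

Lemma raw_risk_le k :
  ('E_P[fun w => ((y k w - theta k) ^+ 2)%R] <=
   (eps ^+ 2 * (t^-1 * Num.sqrt lam))%:E)%E.
Proof.
rewrite unlock EFinM; apply: (@le_trans _ _
  (\int[P]_w ((eps ^+ 2)%:E * (z k w ^+ 2)%:E))%E).
  rewrite le_eqVlt; apply/orP; left; apply/eqP; apply: eq_integral => w _.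
  by rewrite /y -EFinM; congr (_%:E); ring.
rewrite ge0_integralZl_EFin ?sqr_ge0//; last 2 first.
- by move=> w _; rewrite lee_fin sqr_ge0.
- exact/measurable_EFinP.
rewrite lee_wpmul2l ?lee_fin ?sqr_ge0//.
exact: integral_sqr_le.
Qed.

Let sum_loss : (\sum_(k in S) 'E_P[loss k] = \int[P]_w (\sum_(k in S) loss k w)%:E)%E.
Proof.
under [RHS]eq_integral do rewrite -sumEFin -big_enum.
rewrite ge0_integral_sum//=.
- by rewrite big_enum/=; apply: eq_bigr => k _; rewrite unlock.
- by move=> k; exact/measurable_EFinP.
- by move=> k w _; rewrite lee_fin sqr_ge0.
Qed.

Let mexcess : measurable_fun setT
  (fun w => Num.max (\sum_(i in S) z i w ^+ 2 - lam * m) 0).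
Proof. by apply: measurable_maxr => //; exact: measurable_funB. Qed.

Let nn_sum (x : I -> R) : 0 <= \sum_(i in S) x i ^+ 2.
Proof. by apply: sumr_ge0 => i _; exact: sqr_ge0. Qed.

Let sum_loss_ge0 w : 0 <= \sum_(k in S) loss k w.
Proof. by apply: sumr_ge0 => k _; exact: sqr_ge0. Qed.

Let msum_loss : measurable_fun setT (fun w => \sum_(k in S) loss k w).
Proof. exact: measurable_sum_set. Qed.

Hypothesis S_gt0 : (0 < #|S|)%N.

Let tau_gt0 : 0 < tau.
Proof.
by rewrite !mulr_gt0 ?exprn_gt0 ?ltr0n// (lt_trans _ lam_gt1).
Qed.

Lemma block_risk_le_signal :
  (\sum_(k in S) 'E_P[loss k] <=
   (18 * \sum_(k in S) theta k ^+ 2 + 4 * t^-1 * (eps ^+ 2 * expR (- m)))%:E)%E.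
Proof.
rewrite sum_loss; apply: (@le_trans _ _ (\int[P]_w
  ((18 * \sum_(k in S) theta k ^+ 2)%:E + (4 * eps ^+ 2)%:E *
   (Num.max (\sum_(i in S) z i w ^+ 2 - lam * m) 0)%:E))%E).
  apply: ge0_le_integral => //.
  - by move=> w _; rewrite lee_fin.
  - exact/measurable_EFinP.
  - apply/measurable_EFinP; apply: measurable_funD => //.
    exact: measurable_funM.
  - move=> w _; rewrite lee_fin.
    have := shrinkage_loss_le_signal S theta (fun k => eps * z k w) tau_gt0.
    move=> /le_trans; apply; rewrite lerD2l -mulrA ler_pM2l//.
    rewrite maxr_pMr ?sqr_ge0// mulr0 le_eqVlt; apply/orP; left; apply/eqP.
    congr Num.max; rewrite mulrBr mulr_sumr /tau; congr (_ - _); last by ring.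
    by apply: eq_bigr => i _; rewrite exprMn.
rewrite ge0_integralD//=; last 3 first.
- by move=> w _; rewrite lee_fin mulr_ge0.
- move=> w _; apply: mule_ge0; rewrite lee_fin; last by rewrite le_max lexx orbT.
  by rewrite mulr_ge0 ?sqr_ge0.
- by apply/measurable_EFinP; apply: measurable_funM.
rewrite integral_cst//= probability_setT mule1 EFinD leeD2l//.
rewrite ge0_integralZl_EFin//; last 3 first.
- by move=> w _; rewrite lee_fin le_max lexx orbT.
- exact/measurable_EFinP.
- by rewrite mulr_ge0 ?sqr_ge0.
have -> : 4 * t^-1 * (eps ^+ 2 * expR (- m)) =
  (4 * eps ^+ 2) * (t^-1 * expR (- m)) by ring.
rewrite [leRHS]EFinM lee_wpmul2l ?lee_fin ?(mulr_ge0 _ (sqr_ge0 _))//.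
exact: chi_square_excess.
Qed.

Lemma block_risk_le_noise :
  (\sum_(k in S) 'E_P[loss k] <=
   ((2 * lam + 2 * (t^-1 * Num.sqrt lam)) * (m * eps ^+ 2))%:E)%E.
Proof.
rewrite sum_loss; apply: (@le_trans _ _ (\int[P]_w
  ((2 * tau)%:E + \sum_(k <- enum S) (2 * eps ^+ 2)%:E * (z k w ^+ 2)%:E))%E).
  apply: ge0_le_integral => //.
  - by move=> w _; rewrite lee_fin.
  - exact/measurable_EFinP.
  - apply: emeasurable_funD => //; apply: emeasurable_sum => k.
    by apply/measurable_EFinP; apply: measurable_funM.
  - move=> w _; rewrite big_enum/= sumEFin lee_fin.
    have := shrinkage_loss_le_noise S theta (fun k => eps * z k w) tau_gt0.
    move=> /le_trans; apply; rewrite lerD2l mulr_sumr; apply: ler_sum => k _.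
    by rewrite exprMn mulrA.
have term_ge0 k w : (0 <= (2 * eps ^+ 2)%:E * (z k w ^+ 2)%:E)%E.
  by apply: mule_ge0; rewrite lee_fin ?sqr_ge0// (mulr_ge0 _ (sqr_ge0 _)).
have mterm k : measurable_fun setT
    (fun w => ((2 * eps ^+ 2)%:E * (z k w ^+ 2)%:E)%E).
  by apply/measurable_EFinP; apply: measurable_funM.
rewrite ge0_integralD//=; last 3 first.
- by move=> w _; rewrite lee_fin mulr_ge0// ltW.
- by move=> w _; rewrite sume_ge0.
- exact: emeasurable_sum.
rewrite integral_cst//= probability_setT mule1 ge0_integral_sum// big_enum/=.
apply: (@le_trans _ _ ((2 * tau)%:E +
  \sum_(k in S) (2 * eps ^+ 2 * (t^-1 * Num.sqrt lam))%:E)%E).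
  rewrite leeD2l//; apply: lee_sum => k _.
  rewrite ge0_integralZl_EFin//; last 3 first.
  - by move=> w _; rewrite lee_fin sqr_ge0.
  - exact/measurable_EFinP.
  - by rewrite mulr_ge0 ?sqr_ge0.
  rewrite [leRHS]EFinM lee_wpmul2l ?lee_fin ?(mulr_ge0 _ (sqr_ge0 _))//.
  exact: integral_sqr_le.
rewrite sumEFin -EFinD lee_fin sumr_const -mulr_natl -/m /tau.
rewrite le_eqVlt; apply/orP; left; apply/eqP; ring.
Qed.

Lemma block_risk_le :
  (\sum_(k in S) 'E_P[loss k] <=
   ((18 + 2 * lam + 2 * (t^-1 * Num.sqrt lam)) *
      Num.min (\sum_(k in S) theta k ^+ 2) (m * eps ^+ 2)
    + 4 * t^-1 * (eps ^+ 2 * expR (- m)))%:E)%E.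
Proof.
have lam0 : 0 < lam by rewrite (lt_trans _ lam_gt1).
have g0 : 0 <= t^-1 * Num.sqrt lam by rewrite mulr_ge0 ?sqrtr_ge0 ?invr_ge0 ?ltW.
have e0 : 0 <= 4 * t^-1 * (eps ^+ 2 * expR (- m)).
  by rewrite !mulr_ge0 ?sqr_ge0 ?expR_ge0 ?invr_ge0 ?ltW.
case: (leP (\sum_(k in S) theta k ^+ 2) (m * eps ^+ 2)) => _.
- apply: (le_trans block_risk_le_signal); rewrite lee_fin lerD2r.
  rewrite ler_wpM2r//; lra.
- apply: (le_trans block_risk_le_noise); rewrite lee_fin.
  apply: (@le_trans _ _ ((18 + 2 * lam + 2 * (t^-1 * Num.sqrt lam)) *
      (m * eps ^+ 2))); last by rewrite lerDl.
  rewrite ler_wpM2r ?(mulr_ge0 (ler0n _ _) (sqr_ge0 _))//; lra.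
Qed.

End block_risk.

(** * Cardinals and disjointness of the blocks *)

Section block_geometry.
Context {R : realType} {d : nat}.
Implicit Types (r cs ups : R) (mu : 'I_d -> R) (n j : nat).

Lemma powR_dstar mu j : \prod_(i < d) 2 `^ (mu i * j%:R) = 2 `^ (dstar mu * j%:R) :> R.
Proof.
rewrite /dstar mulr_suml; elim/big_rec2 : _ => [|i x y _ ->].
  by rewrite powRr0.
by rewrite powRD// pnatr_eq0/= implybT.
Qed.

Lemma card_Dset_le mu j : #|Dset mu j|%:R <= 2 `^ (dstar mu * j%:R) :> R.
Proof.
rewrite /Dset card_dep_ffun foldrE big_map big_enum/= natr_prod -powR_dstar.
apply: ler_prod => i _; rewrite ler0n/= card_ord.
by rewrite truncn_le powR_ge0.
Qed.

Lemma card_Bset_le cs ups j : 0 <= cs ->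
  #|Bset cs ups j|%:R <= cs * 2 `^ (ups * j%:R) :> R.
Proof.
by move=> cs0; rewrite card_ord truncn_le mulr_ge0// powR_ge0.
Qed.

(** Every block lies entirely inside the box of positions, so all blocks have exactly L^d elements
    and rounding only leaves positions outside all blocks. *)
Lemma block_fits r mu n j (K : Aset r mu n j) (i : 'I_d) :
  ((K i).+1 * blockLen (d := d) r n <= Num.truncn (2 `^ (mu i * j%:R)))%N.
Proof.
have := ltn_ord (K i); move: (nat_of_ord (K i)) => a.
set L := blockLen r n; have [->|L0] := posnP L; first by rewrite muln0.
move=> aL; rewrite truncn_ge_nat ?powR_ge0// natrM.
rewrite -ler_pdivlMr ?ltr0n//.
apply: (@le_trans _ _ (Num.truncn (2 `^ (mu i * j%:R) / L%:R))%:R).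
  by rewrite ler_nat.
by rewrite truncn_le divr_ge0// powR_ge0.
Qed.

Lemma card_ord_window N a L : (a + L <= N)%N ->
  #|[pred x : 'I_N | (a <= x < a + L)%N]| = L.
Proof.
move=> aLN; have ltN (x : 'I_L) : (a + x < N)%N.
  by rewrite (leq_trans _ aLN)// ltn_add2l.
pose f (x : 'I_L) : 'I_N := Ordinal (ltN x).
have injf : injective f by move=> x y /(congr1 val)/= /addnI /val_inj.
rewrite -[RHS]card_ord -(fintype.card_image injf predT); apply: eq_card => x.
rewrite [LHS]inE; apply/idP/fintype.imageP => [/andP[ax xaL]|[y _ ->]/=].
  have xL : (x - a < L)%N by rewrite ltn_subLR.
  by exists (Ordinal xL) => //; apply: val_inj; rewrite /= subnKC.
by rewrite leq_addr ltn_add2l ltn_ord.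
Qed.

Lemma card_block r mu n j (K : Aset r mu n j) :
  #|block K| = (blockLen (d := d) r n ^ d)%N.
Proof.
set L := blockLen r n.
pose W (i : 'I_d) := [pred x : 'I_(Num.truncn (2 `^ (mu i * j%:R))) |
  (K i * L <= x < (K i).+1 * L)%N].
transitivity #|(family W : {pred Dset mu j})|.
  apply: eq_card => k; rewrite inE; apply/forallP/familyP => H i; exact: H.
rewrite card_family foldrE big_map big_enum/=.
rewrite (eq_bigr (fun=> L)) ?prod_nat_const ?card_ord// => i _.
rewrite -[RHS](@card_ord_window (Num.truncn (2 `^ (mu i * j%:R))) (K i * L) L).
  by apply: eq_card => x; rewrite !inE mulSn addnC.
by have := block_fits K i; rewrite mulSn addnC.
Qed.

Lemma card_Aset_le r mu n j :
  #|Aset r mu n j|%:R * (blockLen (d := d) r n)%:R ^+ d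
    <= 2 `^ (dstar mu * j%:R) :> R.
Proof.
set L := blockLen r n.
rewrite /Aset card_dep_ffun foldrE big_map big_enum/= natr_prod -powR_dstar.
rewrite -[X in _ ^+ X](card_ord d) -prodr_const -big_split/=.
apply: ler_prod => i _; rewrite mulr_ge0//= card_ord -/L.
have [->|L0] := posnP L; first by rewrite mulr0 powR_ge0.
by rewrite -ler_pdivlMr ?ltr0n// truncn_le divr_ge0// powR_ge0.
Qed.

Lemma block_inj r mu n j (K K' : Aset r mu n j) k :
  k \in block K -> k \in block K' -> K = K'.
Proof.
rewrite !inE => /forallP Kk /forallP K'k; apply/ffunP => i; apply: val_inj => /=.
have /andP[a1 b1] := Kk i; have /andP[a2 b2] := K'k i.
have := leq_ltn_trans a1 b2; have := leq_ltn_trans a2 b1.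
rewrite !ltn_mul2r => /andP[_]; rewrite ltnS => h1 /andP[_]; rewrite ltnS => h2.
by apply/eqP; rewrite eqn_leq h1 h2.
Qed.

(** The blocks are disjoint but may miss boundary positions, hence an inequality and the sign
    condition on F. *)
Lemma sum_blocks_le r mu n j (F : Dset mu j -> R) : (forall k, 0 <= F k) ->
  \sum_(K : Aset r mu n j) \sum_(k in block K) F k <= \sum_k F k.
Proof.
move=> F0; under eq_bigr do rewrite big_mkcond; rewrite exchange_big/=.
apply: ler_sum => k _; case: (pickP (fun K : Aset r mu n j => k \in block K)).
  move=> K kK; rewrite (bigD1 K)//= kK big1 ?addr0// => K' K'K.
  by case: ifPn => // kK'; move: K'K; rewrite (block_inj kK' kK) eqxx.
by move=> none; rewrite big1// => K _; rewrite none.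
Qed.

End block_geometry.

(** * Risk of one scale in the three regimes of the estimator *)

Section level_risk.
Context {R : realType} {d : nat} (lam r cs ups : R) (mu : 'I_d -> R) (n : nat).
Context {disp : measure_display} {T : measurableType disp} (P : probability T R).
Context (z : coef_family {RV P >-> R} cs ups mu) (theta : coef_family R cs ups mu).
Hypothesis lam_gt1 : 1 < lam.
Hypothesis lam_root : lam - ln lam = 3.
Hypothesis n_gt0 : (0 < n)%N.

Let L := blockLen (d := d) r n.
Let t : R := (1 - lam^-1) / 2.
Let eps2 : R := n%:R `^ (- r).

(** Up to constants, the risk of an oracle choosing block by block between the raw observations,
    which cost L^d n^-r, and 0, which costs the block energy. *)
Definition blockwise_min j : R :=
  \sum_(l : Bset cs ups j) \sum_(K : Aset r mu n j)
    Num.min (\sum_(k in block K) theta l k ^+ 2) (L%:R ^+ d * eps2).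

Definition level_energy j : R :=
  \sum_(l : Bset cs ups j) \sum_(k : Dset mu j) theta l k ^+ 2.

Definition level_risk j : \bar R :=
  (\sum_(l : Bset cs ups j)
     sumD r ups n (fun k : Dset mu j =>
       'E_P[fun w => ((estimator lam r n (observation r n theta z w) l k
                       - theta l k) ^+ 2)%R]))%E.

Let eps2E : (n%:R `^ (- r / 2)) ^+ 2 = eps2.
Proof.
by rewrite -powR_mulrn ?powR_ge0// -powRrM divfK ?pnatr_eq0.
Qed.

(** By disjointness the block returned by [pick] is K. Comparing the block mean with lam n^-r
    amounts to comparing the block sum with lam L^d n^-r, and both vanish together because L^d is
    nonzero. *)
Lemma estimator_block y j (l : Bset cs ups j) (K : Aset r mu n j) k :
  (0 < L)%N -> blockScales r ups mu n j -> k \in block K ->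
  estimator lam r n y l k =
  y j l k * shrink_factor (lam * (#|block K|%:R * eps2))
              (\sum_(i in block K) y j l i ^+ 2).
Proof.
move=> L0 /andP[j0j jJ] kK; rewrite /estimator ltnNge j0j jJ/=.
case: pickP => [K' kK'|/(_ K)]; last by rewrite kK.
rewrite (block_inj kK' kK) /block_mean_square /shrink_factor card_block -/L.
have Ld0 : (L ^ d)%:R != 0 :> R by rewrite pnatr_eq0 expn_eq0 negb_and -lt0n L0.
rewrite -natrX mulf_eq0 mul1r invr_eq0 (negbTE Ld0)/=.
case: eqP => [_|/eqP Q0]; first by rewrite mulr0.
rewrite /shrink -/eps2; congr (_ * Num.max (1 - _) _); field.
by rewrite Ld0 Q0.
Qed.

Lemma level_risk_blocks j : (0 < L)%N -> blockScales r ups mu n j ->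
  (forall l : Bset cs ups j, iid_std_normal (z l)) ->
  (level_risk j <=
   ((18 + 2 * lam + 2 * (t^-1 * Num.sqrt lam)) * blockwise_min j
    + 4 * t^-1 * (#|Bset cs ups j|%:R * #|Aset r mu n j|%:R
                  * (eps2 * expR (- (L%:R ^+ d)))))%:E)%E.
Proof.
move=> L0 bj iidz; rewrite /level_risk /sumD bj.
set C1 := 18 + _ + _; set C2 := 4 * t^-1.
apply: (@le_trans _ _ (\sum_(l : Bset cs ups j) \sum_(K : Aset r mu n j)
  (C1 * Num.min (\sum_(k in block K) theta l k ^+ 2) (L%:R ^+ d * eps2)
    + C2 * (eps2 * expR (- (L%:R ^+ d))))%:E)%E).
  apply: lee_sum => l _; apply: lee_sum => K _.
  have cardK : #|block K|%:R = L%:R ^+ d :> R by rewrite card_block natrX.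
  have eps0 : 0 < n%:R `^ (- r / 2) :> R by apply: powR_gt0; rewrite ltr0n.
  have K0 : (0 < #|block K|)%N by rewrite card_block expn_gt0 L0.
  have := block_risk_le (theta l) (iidz l) lam_gt1 lam_root eps0 K0.
  rewrite eps2E cardK; apply: le_trans; rewrite le_eqVlt; apply/orP; left; apply/eqP.
  apply: eq_bigr => k kK; congr ('E_P[_])%E; apply/funext => w.
  by rewrite (estimator_block _ _ L0 bj kK) cardK.
under eq_bigr do rewrite sumEFin.
rewrite sumEFin lee_fin /blockwise_min mulr_sumr.
set c := C2 * _.
apply: (@le_trans _ _ (\sum_(l : Bset cs ups j) (C1 * \sum_(K : Aset r mu n j)
    Num.min (\sum_(k in block K) theta l k ^+ 2) (L%:R ^+ d * eps2)
  + c *+ #|Aset r mu n j|))).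
  by apply: ler_sum => l _; rewrite big_split/= sumr_const -mulr_sumr.
rewrite big_split/= sumr_const lerD2l /c -!mulr_natr.
rewrite le_eqVlt; apply/orP; left; apply/eqP; ring.
Qed.

Lemma level_risk_coarse j : (j < coarseScale r mu n)%N ->
  (forall l : Bset cs ups j, iid_std_normal (z l)) ->
  (level_risk j <=
   ((t^-1 * Num.sqrt lam) * (#|Bset cs ups j|%:R * #|Dset mu j|%:R * eps2))%:E)%E.
Proof.
move=> jj0 iidz; rewrite /level_risk /sumD /blockScales leqNgt jj0/=.
have eps0 : 0 < n%:R `^ (- r / 2) :> R by apply: powR_gt0; rewrite ltr0n.
apply: (@le_trans _ _ (\sum_(l : Bset cs ups j) \sum_(k : Dset mu j)
  (eps2 * (t^-1 * Num.sqrt lam))%:E)%E).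
  apply: lee_sum => l _; apply: lee_sum => k _.
  have := raw_risk_le (n%:R `^ (- r / 2)) (theta l) (iidz l) lam_gt1 k.
  rewrite eps2E; apply: le_trans; rewrite le_eqVlt; apply/orP; left; apply/eqP.
  by congr ('E_P[_])%E; apply/funext => w; rewrite /estimator jj0.
under eq_bigr do rewrite sumEFin sumr_const.
rewrite sumEFin sumr_const lee_fin -[X in X <= _]mulr_natl -mulr_natl.
rewrite le_eqVlt; apply/orP; left; apply/eqP; ring.
Qed.

Lemma level_risk_fine j : (coarseScale r mu n <= j)%N ->
  (maxScale r ups mu n < j)%N ->
  (level_risk j <= (level_energy j)%:E)%E.
Proof.
move=> j0j Jj; rewrite /level_risk /sumD /blockScales (leqNgt j) Jj andbF.
rewrite /level_energy -sumEFin; apply: lee_sum => l _.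
rewrite -sumEFin; apply: lee_sum => k _.
rewrite unlock; under eq_integral do
  rewrite /estimator ltnNge j0j leqNgt Jj/= sub0r sqrrN.
by rewrite integral_cst//= probability_setT mule1.
Qed.

End level_risk.

(** * Comparison of sums of squares with lp norms *)

Section lp_sums.
Context {R : realType} {I : finType}.
Implicit Types (x : I -> R) (Q : pred I) (p : R).

Lemma sum_powR_norm_ge0 Q p x : 0 <= \sum_(i | Q i) `|x i| `^ p.
Proof. by apply: sumr_ge0 => i _; exact: powR_ge0. Qed.

Lemma sqr_powR_norm (u : R) : u ^+ 2 = `|u| `^ 2.
Proof. by rewrite powR_mulrn// real_normK// num_real. Qed.

(** Each |x i|^p is at most the total A, so x i^2 = |x i|^p |x i|^(2-p) <= |x i|^p A^((2-p)/p);
    summing gives A^(2/p). *)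
Lemma sum_sqr_le_lp Q p x : 0 < p -> p <= 2 ->
  \sum_(i | Q i) x i ^+ 2 <= (\sum_(i | Q i) `|x i| `^ p) `^ (2 / p).
Proof.
move=> p0 p2; set A := \sum_(i | Q i) `|x i| `^ p.
have A0 : 0 <= A by exact: sum_powR_norm_ge0.
have pn0 : p != 0 by rewrite gt_eqF.
have e0 : 0 <= (2 - p) / p by rewrite divr_ge0 ?subr_ge0// ltW.
have bound i : Q i -> x i ^+ 2 <= `|x i| `^ p * A `^ ((2 - p) / p).
  move=> Qi; have xA : `|x i| `^ p <= A.
    by rewrite /A (bigD1 i)//= lerDl; apply: sumr_ge0 => k _; exact: powR_ge0.
  have -> : x i ^+ 2 = `|x i| `^ p * `|x i| `^ (2 - p).
    rewrite -powRD; first by rewrite addrC subrK sqr_powR_norm.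
    by rewrite addrC subrK pnatr_eq0.
  rewrite ler_wpM2l ?powR_ge0//.
  rewrite (_ : `|x i| `^ (2 - p) = (`|x i| `^ p) `^ ((2 - p) / p)).
    by apply: ge0_ler_powR => //; rewrite nnegrE// powR_ge0.
  by rewrite -powRrM; congr (_ `^ _); rewrite mulrC divfK.
apply: (le_trans (ler_sum _ bound)).
rewrite -mulr_suml -/A -{1}[A]powRr1// -powRD.
  rewrite le_eqVlt; apply/orP; left; apply/eqP; congr (_ `^ _); field.
  by [].
apply/implyP => /eqP h; have : 1 + (2 - p) / p != 0 by rewrite gt_eqF// ltr_pwDl.
by rewrite h eqxx.
Qed.

(** Interpolation: min(E, c) <= c^(1-p/2) E^(p/2), and E^(p/2) <= A by the previous inclusion. With
    c the noise energy of a block, this is how the block size enters the bound for p < 2. *)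
Lemma min_sum_sqr_le_lp Q p x (c : R) : 0 < p -> p <= 2 -> 0 < c ->
  Num.min (\sum_(i | Q i) x i ^+ 2) c <=
  c `^ (1 - p / 2) * \sum_(i | Q i) `|x i| `^ p.
Proof.
move=> p0 p2 c0; set E := \sum_(i | Q i) x i ^+ 2.
set A := \sum_(i | Q i) `|x i| `^ p.
have E0 : 0 <= E by apply: sumr_ge0 => i _; exact: sqr_ge0.
have A0 : 0 <= A by exact: sum_powR_norm_ge0.
have pn0 : p != 0 by rewrite gt_eqF.
have hp : 0 <= 1 - p / 2 by rewrite subr_ge0 ler_pdivrMr// mul1r.
have EA : E `^ (p / 2) <= A.
  apply: (@le_trans _ _ ((A `^ (2 / p)) `^ (p / 2))).
    apply: ge0_ler_powR; rewrite ?nnegrE ?powR_ge0//; last exact: sum_sqr_le_lp.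
    by rewrite divr_ge0// ltW.
  by rewrite -powRrM (_ : 2 / p * (p / 2) = 1) ?powRr1//; field.
apply: (@le_trans _ _ (c `^ (1 - p / 2) * E `^ (p / 2))); last first.
  by rewrite ler_wpM2l ?powR_ge0.
have split (u : R) : 0 <= u -> u = u `^ (1 - p / 2) * u `^ (p / 2).
  move=> u0; rewrite -powRD ?subrK ?powRr1// oner_eq0//.
have h0 : 0 <= p / 2 by rewrite divr_ge0// ltW.
case: (leP E c) => [Ec|/ltW cE].
  rewrite {1}(split E)// ler_wpM2r ?powR_ge0//.
  by apply: ge0_ler_powR; rewrite ?nnegrE// ltW.
rewrite {1}(split c) ?(ltW c0)// ler_wpM2l ?powR_ge0//.
by apply: ge0_ler_powR; rewrite ?nnegrE// ltW.
Qed.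

Lemma lp_norm_ge0 (p : \bar R) x : 0 <= lp_norm p x.
Proof.
case: p => [p| |] /=; first exact: powR_ge0;
by elim/big_rec : _ => // i y _ y0; rewrite le_max y0 orbT.
Qed.

(* Truncating at the level [h] with [#|I| h^p = sum |x|^p] replaces Hölder. *)
Lemma sum_sqr_le_lp_norm (p : \bar R) x : (2%:E <= p)%E ->
  \sum_i x i ^+ 2 <=
  2 * #|I|%:R `^ (1 - 2 * fine (p^-1)%E) * lp_norm p x ^+ 2.
Proof.
case: p => [p| |]//=; last first.
  move=> _; rewrite mulr0 subr0 powRr1 ?ler0n//.
  set N := \big[Num.max/0]_i `|x i|.
  have N0 : 0 <= N by exact: (@lp_norm_ge0 +oo%E x).
  apply: (@le_trans _ _ (\sum_(i : I) N ^+ 2)).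
    apply: ler_sum => i _; rewrite -(real_normK (num_real (x i))).
    by rewrite ler_pXn2r ?nnegrE//; exact: le_bigmax.
  rewrite sumr_const -[leLHS]mulr_natl -mulrA.
  have := mulr_ge0 (ler0n R #|I|) (sqr_ge0 N); lra.
rewrite lee_fin => p2.
have p0 : 0 < p by rewrite (lt_le_trans _ p2).
have pn0 : p != 0 by rewrite gt_eqF.
rewrite /inve/= (negbTE pn0) /=.
set A := \sum_i `|x i| `^ p; set D : R := #|I|%:R.
have A0 : 0 <= A by exact: sum_powR_norm_ge0.
have [A_eq0|A_neq0] := eqVneq A 0.
  rewrite big1 ?mulr_ge0 ?powR_ge0 ?sqr_ge0// => i _.
  have : \sum_i `|x i| `^ p == 0 by rewrite -/A A_eq0.
  rewrite psumr_eq0; last by move=> k _; exact: powR_ge0.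
  move=> /allP/(_ i (mem_index_enum _)); rewrite powR_eq0 normr_eq0.
  by move=> /andP[/eqP -> _]; rewrite expr0n.
have Ap : 0 < A by rewrite lt_neqAle eq_sym A_neq0.
have Dp : 0 < D.
  rewrite ltr0n lt0n; apply: contra A_neq0 => /eqP/card0_eq I0.
  by rewrite /A big1// => i _; have := I0 i; rewrite inE.
pose h := (A / D) `^ p^-1.
have hp : 0 < h by rewrite powR_gt0// divr_gt0.
have hpE : h `^ p = A / D.
  by rewrite -powRrM mulVf// powRr1// divr_ge0// ltW.
(* Above [h] the second term suffices, since 2 - p <= 0 gives |x|^(2-p) <= h^(2-p). By the choice of
   [h] both terms have the same sum D h^2, whence the factor 2. *)
have bound i : x i ^+ 2 <= h ^+ 2 + `|x i| `^ p * h `^ (2 - p).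
  have [xh|hx] := lerP `|x i| h.
    rewrite -(real_normK (num_real (x i))).
    rewrite ler_wpDr ?mulr_ge0 ?powR_ge0//.
    by rewrite ler_pXn2r ?nnegrE ?(ltW hp).
  rewrite ler_wpDl ?sqr_ge0//.
  have -> : x i ^+ 2 = `|x i| `^ p * `|x i| `^ (2 - p).
    rewrite -powRD; first by rewrite addrC subrK sqr_powR_norm.
    by rewrite addrC subrK pnatr_eq0.
  have xp := lt_trans hp hx.
  rewrite ler_wpM2l ?powR_ge0// -[2 - p]opprB !powRN lef_pV2 ?posrE ?(powR_gt0 _ xp) ?(powR_gt0 _ hp)//.
  by apply: ge0_ler_powR; rewrite ?nnegrE ?subr_ge0 ?(ltW hp) ?(ltW hx).
apply: (@le_trans _ _ (\sum_i (h ^+ 2 + `|x i| `^ p * h `^ (2 - p)))).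
  by apply: ler_sum => i _; exact: bound.
have Ah : A * h `^ (2 - p) = D * h ^+ 2.
  have -> : A = D * h `^ p by rewrite hpE mulrC divfK// gt_eqF.
  rewrite -mulrA -powRD; last by rewrite addrC subrK pnatr_eq0.
  by rewrite addrC subrK powR_mulrn ?(ltW hp).
have Dh : D * h ^+ 2 = D `^ (1 - 2 / p) * A `^ p^-1 ^+ 2.
  have -> : h ^+ 2 = D `^ (- (2 / p)) * A `^ p^-1 ^+ 2.
    rewrite -!powR_mulrn ?powR_ge0// -!powRrM powRM ?invr_ge0 ?(ltW Dp)//.
    rewrite mulrC [p^-1 * 2]mulrC; congr (_ * _).
    by rewrite -powR_inv1 ?(ltW Dp)// -powRrM mulN1r.
  rewrite powRD; last by rewrite (gt_eqF Dp) implybT.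
  by rewrite powRr1 ?(ltW Dp)// mulrA.
rewrite big_split/= sumr_const -mulr_suml -/A Ah -[_ *+ _]mulr_natl.
rewrite -mulrA -Dh.
have -> : #|xpredT : pred I|%:R = D by [].
lra.
Qed.

End lp_sums.

(** * Level energies over the smoothness ball *)

Section smoothness.
Context {R : realType} {d : nat} {cs ups : R} {mu : 'I_d -> R}.
Context (s M : R) (p q : \bar R) (theta : coef_family R cs ups mu).
Hypothesis cs_ge0 : 0 <= cs.
Hypothesis M_gt0 : 0 < M.
Hypothesis p_gt0 : (0 < p)%E.
Hypothesis q_gt0 : (0 < q)%E.
Hypothesis theta_ball : smoothness_ball s p q M theta.

Lemma level_norm_ge0 j (l : Bset cs ups j) : 0 <= level_norm s p theta l.
Proof. by rewrite mulr_ge0 ?powR_ge0 ?lp_norm_ge0. Qed.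

Lemma sum_level_norm_powR_le (q' : R) : q = q'%:E -> forall j,
  \sum_(l : Bset cs ups j) level_norm s p theta l `^ q' <= M `^ q'.
Proof.
move=> qE j; have q'0 : 0 < q' by rewrite -lte_fin -qE.
move: theta_ball; rewrite /smoothness_ball/= qE/=.
set f := fun i : nat => (\sum_(l : Bset cs ups i) (level_norm s p theta l `^ q')%:E)%E.
have f0 i : (0 <= f i)%E by apply: sume_ge0 => l _; rewrite lee_fin powR_ge0.
rewrite -/f => H.
have SM : (\sum_(0 <= i <oo) f i <= (M `^ q')%:E)%E.
  rewrite -poweR_EFin -[leLHS]poweRe1; last exact: nneseries_ge0.
  rewrite -(@mulVf _ q') ?gt_eqF// poweRrM.
  apply: gt0_ler_poweR => //; first exact: ltW.
  - by rewrite in_itv/= poweR_ge0 leey.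
  - by rewrite in_itv/= lee_fin (ltW M_gt0) leey.
rewrite -lee_fin -sumEFin; apply: le_trans SM.
apply: (le_trans _ (nneseries_lim_ge j.+1 _)) => //.
by rewrite big_nat_recr//= leeDr// sume_ge0.
Qed.

Lemma level_norm_le j (l : Bset cs ups j) : level_norm s p theta l <= M.
Proof.
case: q q_gt0 theta_ball (@sum_level_norm_powR_le) => [q'| |]//= q'0 H sumle.
  have {}q'0 : 0 < q' by rewrite -lte_fin.
  have := sumle q' erefl j; rewrite (bigD1 l)//= => H1.
  have : level_norm s p theta l `^ q' <= M `^ q'.
    by apply: le_trans H1; rewrite lerDl; apply: sumr_ge0 => k _; exact: powR_ge0.
  move=> /(@ge0_ler_powR _ q'^-1).
  rewrite !nnegrE !powR_ge0 invr_ge0 (ltW q'0) => /(_ isT isT isT).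
  by rewrite -!powRrM mulfV ?gt_eqF// !powRr1 ?level_norm_ge0// ltW.
move: H; rewrite /smoothness_ball/= => H; rewrite -lee_fin.
by apply: le_trans H; apply: ereal_sup_ubound; exists j, l.
Qed.

(** The two alternatives become interchangeable here. If q <= e, the surplus power u^(e-q) of each
    level norm is at most M^(e-q); if ups = 0, there are at most cs labels, each with level norm at
    most M. The factor 1 + cs covers both. *)
Lemma sum_level_norm_le (e : R) : 0 < e -> (q <= e%:E)%E \/ ups = 0 -> forall j,
  \sum_(l : Bset cs ups j) level_norm s p theta l `^ e <= (1 + cs) * M `^ e.
Proof.
move=> e0 qe j; have Me0 : 0 < M `^ e by exact: powR_gt0.
case: qe => [qe|ups0].
  case: q q_gt0 qe (@sum_level_norm_powR_le) => [q'| |]// q'0.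
  rewrite lee_fin => qe sumle.
  have {}q'0 : 0 < q' by rewrite -lte_fin.
  have split u : u `^ e = u `^ q' * u `^ (e - q').
    by rewrite -powRD addrC subrK// (gt_eqF e0).
  apply: (@le_trans _ _ (\sum_(l : Bset cs ups j)
     level_norm s p theta l `^ q' * M `^ (e - q'))).
    apply: ler_sum => l _; rewrite split ler_wpM2l ?powR_ge0//.
    by apply: ge0_ler_powR; rewrite ?nnegrE ?subr_ge0 ?level_norm_ge0 ?level_norm_le ?(ltW M_gt0).
  rewrite -mulr_suml; apply: (@le_trans _ _ (M `^ e)); last first.
    by rewrite ler_peMl ?(ltW Me0)// lerDl.
  by rewrite [leRHS]split ler_wpM2r ?powR_ge0//; exact: sumle.
apply: (@le_trans _ _ (\sum_(l : Bset cs ups j) M `^ e)).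
  apply: ler_sum => l _.
  by apply: ge0_ler_powR; rewrite ?nnegrE ?level_norm_ge0 ?level_norm_le ?(ltW M_gt0) ?(ltW e0).
rewrite sumr_const -[leLHS]mulr_natl ler_wpM2r ?(ltW Me0)//.
have := @card_Bset_le _ cs ups j cs_ge0.
by rewrite ups0 mul0r powRr0 mulr1 => /le_trans; apply; rewrite lerDr.
Qed.

Let ip : R := fine (p^-1)%E.

Lemma lp_normE j (l : Bset cs ups j) :
  lp_norm p (theta l) =
  2 `^ (- (j%:R * (s + dstar mu / 2 - dstar mu * ip))) * level_norm s p theta l.
Proof.
by rewrite /level_norm mulrA -powRD ?addNr ?powRr0 ?mul1r// pnatr_eq0 implybT.
Qed.

Let ipE (p' : R) : p = p'%:E -> ip = p'^-1.
Proof.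
move=> pE; have p'0 : 0 < p' by rewrite -lte_fin -pE.
by rewrite /ip pE /inve gt_eqF.
Qed.

(** The cardinal factor 2^(j dstar (1 - 2/p)) cancels the part dstar/2 - dstar/p of the weight, so
    the decay does not depend on p. *)
Lemma level_energy_ge2 j : (2%:E <= p)%E -> (q <= 2%:E)%E \/ ups = 0 ->
  level_energy theta j <= 2 * (1 + cs) * M ^+ 2 * 2 `^ (- (2 * s) * j%:R).
Proof.
move=> p2 qe.
have ip2 : 0 <= 1 - 2 * ip.
  rewrite /ip; case: p p_gt0 p2 => [p'| |]//=.
  rewrite !lte_fin !lee_fin => p'0 p'2.
  by rewrite /inve gt_eqF//= subr_ge0 ler_pdivrMr// mul1r.
apply: (@le_trans _ _ (\sum_(l : Bset cs ups j)
   2 * 2 `^ (- (2 * s) * j%:R) * level_norm s p theta l `^ 2)).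
  apply: ler_sum => l _; apply: (le_trans (sum_sqr_le_lp_norm _ p2)).
  rewrite powR_mulrn ?level_norm_ge0// lp_normE exprMn mulrA.
  rewrite ler_wpM2r ?sqr_ge0// -mulrA ler_wpM2l//.
  rewrite -powR_mulrn ?powR_ge0// -powRrM.
  apply: (@le_trans _ _ ((2 `^ (dstar mu * j%:R)) `^ (1 - 2 * ip) *
     2 `^ (- (j%:R * (s + dstar mu / 2 - dstar mu * ip)) * 2))).
    rewrite ler_wpM2r ?powR_ge0//; apply: ge0_ler_powR; rewrite ?nnegrE ?powR_ge0//.
    exact: card_Dset_le.
  rewrite -powRrM -powRD ?pnatr_eq0 ?implybT// le_eqVlt; apply/orP; left.
  by apply/eqP; congr (_ `^ _); field.
rewrite -mulr_sumr; have := sum_level_norm_le (ltr0n R 2) qe j.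
rewrite [M `^ 2]powR_mulrn ?(ltW M_gt0)// => H.
have := ler_wpM2l (mulr_ge0 (ler0n R 2) (powR_ge0 2 (- (2 * s) * j%:R))) H.
move=> /le_trans; apply; rewrite le_eqVlt; apply/orP; left; apply/eqP; ring.
Qed.

(** The inclusion of lp in l2 carries no cardinal factor for p < 2, so the smoothness drops from s
    to s + dstar/2 - dstar/p. *)
Lemma level_energy_lt2 (p' : R) j : p = p'%:E -> p' < 2 ->
  (q <= 2%:E)%E \/ ups = 0 ->
  level_energy theta j <= 2 * (1 + cs) * M ^+ 2 *
    2 `^ (- (2 * (s + dstar mu / 2 - dstar mu / p')) * j%:R).
Proof.
move=> pE p2 qe; have p'0 : 0 < p' by rewrite -lte_fin -pE.
set s' := s + _ - _.
apply: (@le_trans _ _ (\sum_(l : Bset cs ups j)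
   2 `^ (- (2 * s') * j%:R) * level_norm s p theta l `^ 2)).
  apply: ler_sum => l _; apply: (le_trans (sum_sqr_le_lp _ _ p'0 (ltW p2))).
  rewrite (_ : (\sum_i _) `^ (2 / p') = lp_norm p (theta l) `^ 2); last first.
    by rewrite pE /= -powRrM mulrC.
  rewrite lp_normE (ipE pE) powRM ?powR_ge0 ?level_norm_ge0//.
  rewrite -powRrM le_eqVlt; apply/orP; left; apply/eqP; congr (_ `^ _ * _).
  by rewrite /s'; field; rewrite gt_eqF.
rewrite -mulr_sumr; have := sum_level_norm_le (ltr0n R 2) qe j.
rewrite [M `^ 2]powR_mulrn ?(ltW M_gt0)// => H.
have := ler_wpM2l (powR_ge0 2 (- (2 * s') * j%:R)) H.
move=> /le_trans; apply.
have := mulr_ge0 (powR_ge0 2 (- (2 * s') * j%:R)) (mulr_ge0 (ltW (ltr_pwDl ltr01 cs_ge0)) (sqr_ge0 M)).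
lra.
Qed.

Lemma blockwise_min_le_energy r n j :
  blockwise_min r n theta j <= level_energy theta j.
Proof.
apply: ler_sum => l _.
apply: (le_trans _ (@sum_blocks_le _ _ r mu n j (fun k => theta l k ^+ 2) _)).
  by apply: ler_sum => K _; rewrite ge_min lexx.
by move=> k; exact: sqr_ge0.
Qed.

Lemma blockwise_min_le_noise r n j :
  blockwise_min r n theta j <= cs * 2 `^ ((dstar mu + ups) * j%:R) * n%:R `^ (- r).
Proof.
apply: (@le_trans _ _ (#|Bset cs ups j|%:R *
  (#|Aset r mu n j|%:R * (blockLen (d := d) r n)%:R ^+ d) * n%:R `^ (- r))).
  apply: (@le_trans _ _ (\sum_(l : Bset cs ups j) \sum_(K : Aset r mu n j)
    ((blockLen (d := d) r n)%:R ^+ d * n%:R `^ (- r)))).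
    by apply: ler_sum => l _; apply: ler_sum => K _; rewrite ge_min lexx orbT.
  rewrite sumr_const sumr_const -[X in X *+ _]mulr_natl -[leLHS]mulr_natl.
  by rewrite !mulrA.
rewrite ler_wpM2r ?powR_ge0// mulrDl powRD ?pnatr_eq0 ?implybT//.
rewrite [2 `^ _ * _]mulrC [leRHS]mulrA; apply: ler_pM => //.
- exact: card_Bset_le.
- exact: card_Aset_le.
Qed.

(** After interpolation on each block, the sums of |theta|^p' over disjoint blocks recombine into
    the p'-th power of the lp norm of the level. *)
Lemma blockwise_min_lt2 (p' : R) r n j : p = p'%:E -> p' < 2 ->
  (q <= p)%E \/ ups = 0 -> (0 < blockLen (d := d) r n)%N -> (0 < n)%N ->
  blockwise_min r n theta j <=
  (1 + cs) * M `^ p' *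
  (((blockLen (d := d) r n)%:R ^+ d * n%:R `^ (- r)) `^ (1 - p' / 2) *
   2 `^ (- (s * p' + dstar mu * p' / 2 - dstar mu) * j%:R)).
Proof.
move=> pE p2 qe L0 n0; have p'0 : 0 < p' by rewrite -lte_fin -pE.
set c := _ ^+ d * _; set w := 2 `^ _.
have c0 : 0 < c by rewrite mulr_gt0 ?exprn_gt0 ?powR_gt0 ?ltr0n.
apply: (@le_trans _ _ (\sum_(l : Bset cs ups j)
   c `^ (1 - p' / 2) * w * level_norm s p theta l `^ p')).
  apply: ler_sum => l _.
  apply: (@le_trans _ _ (\sum_(K : Aset r mu n j) \sum_(k in block K)
     c `^ (1 - p' / 2) * `|theta l k| `^ p')).
    apply: ler_sum => K _; rewrite -mulr_sumr.
    exact: min_sum_sqr_le_lp (ltW p2) c0.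
  apply: (le_trans (sum_blocks_le _ _ _)) => [k|].
    by rewrite mulr_ge0 ?powR_ge0.
  rewrite -mulr_sumr -mulrA ler_wpM2l ?powR_ge0//.
  rewrite (_ : \sum_k _ = lp_norm p (theta l) `^ p'); last first.
    by rewrite pE /= -powRrM mulVf ?gt_eqF// powRr1// sum_powR_norm_ge0.
  rewrite lp_normE (ipE pE) powRM ?powR_ge0 ?level_norm_ge0//.
  rewrite -powRrM le_eqVlt; apply/orP; left; apply/eqP; congr (_ `^ _ * _).
  by field; rewrite gt_eqF.
rewrite -mulr_sumr mulrC; apply: ler_wpM2r; first by rewrite mulr_ge0 ?powR_ge0.
by apply: sum_level_norm_le => //; rewrite -pE.
Qed.

End smoothness.

(** * Geometric sums and the balance of two of them *)

Section geometric_sums.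
Context {R : realType}.
Implicit Types (a c x eta : R) (j m N : nat).

Lemma powR2_exprn a j : 2 `^ (a * j%:R) = (2 `^ a) ^+ j :> R.
Proof. by rewrite powRrM powR_mulrn ?powR_ge0. Qed.

Lemma powR2_gt1 a : 0 < a -> 1 < 2 `^ a :> R.
Proof.
by move=> a0; rewrite /powR pnatr_eq0/= expR_gt1 mulr_gt0// ln_gt0// ltr1n.
Qed.

Lemma powR2_lt1 a : 0 < a -> 2 `^ (- a) < 1 :> R.
Proof. by move=> a0; rewrite powRN invf_lt1 ?powR2_gt1 ?powR_gt0. Qed.

(** The cut at m is an indicator inside a sum over all j < N, so bounds for different ranges of
    scales add termwise and stay uniform in N. Multiplication by 2^a - 1 telescopes the sum. *)
Lemma geometric_sum_below a m N : 0 < a ->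
  \sum_(j < N) (if (j < m)%N then 2 `^ (a * j%:R) else 0) <=
  2 `^ (a * m%:R) / (2 `^ a - 1) :> R.
Proof.
move=> a0; have rho1 := powR2_gt1 a0; rewrite powR2_exprn.
under eq_bigr do rewrite powR2_exprn; move: rho1; set rho := 2 `^ a => rho1.
have d0 : 0 < rho - 1 by rewrite subr_gt0.
rewrite ler_pdivlMr//.
suff : (\sum_(j < N) if (j < m)%N then rho ^+ j else 0) * (rho - 1) =
    rho ^+ minn N m - 1.
  move=> ->; apply: (@le_trans _ _ (rho ^+ minn N m)); first by rewrite gerBl.
  by rewrite ler_weXn2l ?geq_minr// ltW.
elim: N => [|N IH]; first by rewrite big_ord0 mul0r min0n expr0 subrr.
rewrite big_ord_recr/= mulrDl IH; case: ltnP => Nm.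
  by rewrite (minn_idPl Nm) exprS; ring.
by rewrite (minn_idPr (leqW Nm)) mul0r addr0.
Qed.

Lemma geometric_sum_above c m N : 0 < c ->
  \sum_(j < N) (if (m <= j)%N then 2 `^ (- c * j%:R) else 0) <=
  2 `^ (- c * m%:R) / (1 - 2 `^ (- c)) :> R.
Proof.
move=> c0; have rho1 := powR2_lt1 c0; rewrite powR2_exprn.
under eq_bigr do rewrite powR2_exprn.
have : 0 < 2 `^ (- c) :> R by exact: powR_gt0.
move: rho1; set rho := 2 `^ (- c) => rho1 rho0.
have d0 : 0 < 1 - rho by rewrite subr_gt0.
rewrite ler_pdivlMr//.
suff : (\sum_(j < N) if (m <= j)%N then rho ^+ j else 0) * (1 - rho) =
    rho ^+ m - rho ^+ maxn N m.
  by move=> ->; rewrite gerBl exprn_ge0// ltW.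
elim: N => [|N IH]; first by rewrite big_ord0 mul0r max0n subrr.
rewrite big_ord_recr/= mulrDl IH; case: leqP => mN.
  by rewrite (maxn_idPl (leqW mN)) exprS; ring.
by rewrite (maxn_idPr mN) mul0r addr0.
Qed.

Lemma powR_log2 x a : 0 < x -> 2 `^ (a * log2 x) = x `^ a.
Proof.
move=> x0; rewrite /powR pnatr_eq0/= gt_eqF// /log2; congr expR.
by rewrite -mulrA divfK// gt_eqF// ln_gt0// ltr1n.
Qed.

(* The two bounds cross at [2^j = x]. *)
Lemma sum_min_le a c (A B x : R) N : 0 < a -> 0 < c -> 0 <= A -> 0 <= B -> 0 < x ->
  \sum_(j < N) Num.min (A * 2 `^ (a * j%:R)) (B * 2 `^ (- c * j%:R)) <=
  A * x `^ a / (2 `^ a - 1) + 2 `^ c * B * x `^ (- c) / (1 - 2 `^ (- c)).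
Proof.
move=> a0 c0 A0 B0 x0; pose m := Num.truncn (log2 x).
have da : 0 < 2 `^ a - 1 :> R by rewrite subr_gt0 powR2_gt1.
have dc : 0 < 1 - 2 `^ (- c) :> R by rewrite subr_gt0 powR2_lt1.
apply: (@le_trans _ _ (\sum_(j < N)
   (A * (if (j < m)%N then 2 `^ (a * j%:R) else 0)
    + B * (if (m <= j)%N then 2 `^ (- c * j%:R) else 0)))).
  apply: ler_sum => j _; case: ltnP => _.
    by rewrite mulr0 addr0 ge_min lexx.
  by rewrite mulr0 add0r ge_min lexx orbT.
rewrite big_split/= -!mulr_sumr; apply: lerD.
  (* For x < 2, including negative log2 x, truncation gives m = 0: nothing lies below the cut. *)
  have [m0|m0] := posnP m.
    rewrite big1 ?mulr0; last by move=> j _; rewrite m0.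
    by rewrite mulr_ge0 ?invr_ge0 ?(ltW da)// mulr_ge0// powR_ge0.
  rewrite -mulrA ler_wpM2l//; apply: (le_trans (geometric_sum_below _ _ a0)).
  rewrite ler_wpM2r ?invr_ge0 ?(ltW da)// -(powR_log2 _ x0) ler_powR ?ler1n//.
  rewrite ler_pM2l// truncn_le; apply/ltW; rewrite ltNge; apply/negP => lx.
  by move: m0; have := le_truncn lx; rewrite truncn0 leqn0 -/m => /eqP ->.
rewrite [2 `^ c * B]mulrC -!mulrA ler_wpM2l//.
apply: (le_trans (geometric_sum_above _ _ c0)).
rewrite mulrA ler_wpM2r ?invr_ge0 ?(ltW dc)//.
rewrite -(powR_log2 _ x0) -powRD ?pnatr_eq0 ?implybT// ler_powR ?ler1n//.
(* Rounding gives m > log2 x - 1, which costs the factor 2^c. *)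
have := truncnS_gt (log2 x); rewrite -/m -natr1 => h.
by have := ler_wpM2l (ltW c0) (ltW h); lra.
Qed.

(* [p] is the exponent of the [lp]-ball, capped at 2; the powers of [eta] are balanced by [x = eta^(-1/(2s+a))]. *)
Lemma sum_min_rate (a s p K G eta : R) N : 0 < a -> 0 < s ->
  0 < s * p - (1 - p / 2) * a -> 0 <= K -> 0 <= G -> 0 < eta ->
  let c := s * p - (1 - p / 2) * a in
  \sum_(j < N) Num.min (K * eta * 2 `^ (a * j%:R))
                       (G * eta `^ (1 - p / 2) * 2 `^ (- c * j%:R)) <=
  (K / (2 `^ a - 1) + 2 `^ c * G / (1 - 2 `^ (- c))) * eta `^ (2 * s / (2 * s + a)).
Proof.
move=> a0 s0 c0 K0 G0 eta0 /=; set c := _ - _ * a in c0 *; have sa0 : 0 < 2 * s + a by rewrite addr_gt0// mulr_gt0.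
have := @sum_min_le a c (K * eta) (G * eta `^ (1 - p / 2))
  (eta `^ (- (2 * s + a)^-1)) N a0 c0 (mulr_ge0 K0 (ltW eta0))
  (mulr_ge0 G0 (powR_ge0 _ _)) (powR_gt0 _ eta0).
move=> /le_trans; apply; rewrite le_eqVlt; apply/orP; left; apply/eqP.
rewrite -!powRrM -[K * eta]/(K * eta) -{1}[eta]powRr1 ?(ltW eta0)//.
have etaD u v : eta `^ u * eta `^ v = eta `^ (u + v).
  by rewrite powRD// (gt_eqF eta0) implybT.
rewrite -(mulrA K) etaD -(mulrA (2 `^ c)) -(mulrA G) etaD.
rewrite (_ : 1 + _ = 2 * s / (2 * s + a)); last by field; rewrite gt_eqF.
rewrite (_ : 1 - p / 2 + _ = 2 * s / (2 * s + a)); last first.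
  by rewrite /c; field; rewrite gt_eqF.
ring.
Qed.

End geometric_sums.

(** * Logarithms and powers against exponentials *)

Section exponential_bounds.
Context {R : realType}.
Implicit Types (x b delta kappa : R).

(** This is u <= exp u at u = delta x / b, raised to the power b. With x = r log n it absorbs powers
    of log n into a small power of n. *)
Lemma powR_le_expR x b delta : 0 < b -> 0 < delta -> 0 < x ->
  x `^ b <= (b / delta) `^ b * expR (delta * x).
Proof.
move=> b0 d0 x0; have bd : 0 < b / delta by rewrite divr_gt0.
have h : x <= b / delta * expR (delta * x / b).
  rewrite -ler_pdivrMl// invf_div mulrAC; apply: (le_trans _ (expR_ge1Dx _)).
  by rewrite lerDr.
have := ge0_ler_powR (ltW b0) _ _ h; rewrite !nnegrE (ltW x0).
move=> /(_ isT); rewrite mulr_ge0 ?expR_ge0 ?(ltW bd)// => /(_ isT) /le_trans.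
apply; rewrite powRM ?expR_ge0 ?(ltW bd)// le_eqVlt; apply/orP; left; apply/eqP.
congr (_ * _); rewrite /powR expR_eq0 expRK; congr expR.
by field; rewrite gt_eqF.
Qed.

Lemma ln_le_linear (K : R) : 0 < K ->
  exists x0, 0 < x0 /\ forall x, x0 <= x -> ln x <= K * x.
Proof.
move=> K0; exists (Num.max 1 (2 / K * ln (2 / K))); split.
  by rewrite lt_max ltr01.
move=> x; rewrite ge_max => /andP[x1 xl]; have x0 : 0 < x by rewrite (lt_le_trans _ x1).
have K2 : 0 < 2 / K by rewrite divr_gt0.
have : x <= 2 / K * expR (K * x / 2).
  rewrite -ler_pdivrMl// invf_div; apply: (le_trans _ (expR_ge1Dx _)).
  by rewrite mulrAC lerDr.
move=> h; have e0 : 0 < expR (K * x / 2) by exact: expR_gt0.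
have : ln x <= ln (2 / K * expR (K * x / 2)).
  by rewrite ler_ln// posrE; exact: mulr_gt0.
rewrite lnM ?posrE// expRK.
have : ln (2 / K) <= K * x / 2.
  by move: xl; rewrite -ler_pdivlMl// invf_div; lra.
lra.
Qed.

(* By Bernoulli's inequality [(1 - 1/y)^d >= 1 - d/y >= kappa] once [y >= d/(1 - kappa)]. *)
Lemma expR_block_length d x kappa (L : nat) : (0 < d)%N -> 0 < kappa -> kappa < 1 ->
  0 < x -> x `^ d%:R^-1 <= L%:R + 1 ->
  expR (- (L%:R ^+ d)) <=
  expR ((d%:R / (1 - kappa)) ^+ d) * expR (- (kappa * x)).
Proof.
move=> d0 k0 k1 x0 xL; rewrite -expRD ler_expR.
set y0 := d%:R / (1 - kappa); set y := x `^ d%:R^-1.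
have k1' : 0 < 1 - kappa by rewrite subr_gt0.
have dR : 0 < d%:R :> R by rewrite ltr0n.
have y00 : 0 < y0 by rewrite divr_gt0.
have yp : 0 < y by rewrite powR_gt0.
have yd : y ^+ d = x.
  by rewrite -powR_mulrn ?powR_ge0// -powRrM mulVf ?gt_eqF// powRr1// ltW.
suff : kappa * y ^+ d <= L%:R ^+ d + y0 ^+ d by rewrite yd; lra.
(* For small y the additive constant y0^d alone suffices; it becomes the constant factor of the
   conclusion. *)
have [yy|yy] := lerP y y0.
  apply: (@le_trans _ _ (y0 ^+ d)); last by rewrite lerDr exprn_ge0.
  apply: (@le_trans _ _ (y ^+ d)).
    by rewrite ler_piMl ?exprn_ge0 ?(ltW yp)// ltW.
  by rewrite ler_pXn2r// nnegrE ltW.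
apply: (@le_trans _ _ (L%:R ^+ d)); last by rewrite lerDl exprn_ge0 ?(ltW y00).
have y0d : d%:R <= y0.
  by rewrite /y0 ler_pdivlMr// ler_piMr ?(ltW dR)// gerBl ltW.
have y1 : 1 <= y.
  by rewrite (le_trans _ (ltW yy))// (le_trans _ y0d)// ler1n.
apply: (@le_trans _ _ ((y - 1) ^+ d)); last first.
  by rewrite ler_pXn2r// ?nnegrE ?subr_ge0// lerBlDr.
have -> : y - 1 = y * (1 - y^-1) by rewrite mulrBr mulr1 divff ?gt_eqF.
rewrite exprMn mulrC ler_pM2l ?exprn_gt0//.
have yV1 : y^-1 <= 1 by rewrite invf_le1.
have bern : forall m : nat, 1 - m%:R * y^-1 <= (1 - y^-1) ^+ m.
  elim=> [|m IH]; first by rewrite mul0r subr0 expr0.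
  have yV0 : 0 <= y^-1 by rewrite invr_ge0 ltW.
  have h0 : 0 <= 1 - y^-1 by rewrite subr_ge0.
  rewrite exprS -natr1; have := ler_wpM2l h0 IH.
  have : 0 <= m%:R * y^-1 * y^-1 by rewrite !mulr_ge0.
  lra.
apply: (le_trans _ (bern d)).
have : d%:R * y^-1 <= 1 - kappa; last by lra.
rewrite ler_pdivrMr// mulrC -ler_pdivrMr//.
exact: ltW.
Qed.

End exponential_bounds.

(** * Summation of the risk over all scales *)

Section total_risk.
Context {R : realType} {d : nat} (d_gt0 : (0 < d)%N).
Context (r cs ups lam : R) (mu : 'I_d -> R).
Hypothesis r_ge1 : 1 <= r.
Hypothesis cs_ge0 : 0 <= cs.
Hypothesis ups_ge0 : 0 <= ups.
Hypothesis mu_gt0 : forall i, 0 < mu i.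
Hypothesis lam_gt1 : 1 < lam.
Hypothesis lam_root : lam - ln lam = 3.

Let a := dstar mu + ups.
Let xlog (n : nat) : R := r * ln n%:R.

(** The first condition gives L >= 1. The second puts every raw scale at or below the last processed
    one and every scale beyond it in the zero branch. *)
Definition large_sample (n : nat) : Prop :=
  1 <= ln (n%:R : R) /\ (coarseScale r mu n <= (maxScale r ups mu n).+1)%N.

Lemma dstar_gt0 : 0 < dstar mu.
Proof.
rewrite /dstar (bigD1 (Ordinal d_gt0))//= ltr_pwDl//.
by apply: sumr_ge0 => i _; exact: ltW.
Qed.

Let a_gt0 : 0 < a.
Proof. by rewrite ltr_pwDl// dstar_gt0. Qed.

Lemma inf_range_gt0 : 0 < inf (range mu).
Proof.
have [m [m0 mle]] : exists m, 0 < m /\ forall i, m <= mu i.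
  exists (\big[Num.min/mu (Ordinal d_gt0)]_i mu i); split.
    by elim/big_ind : _ => // u v u0 v0; rewrite lt_min u0 v0.
  by move=> i; exact: bigmin_le.
apply: (lt_le_trans m0); apply: lb_le_inf.
  by exists (mu (Ordinal d_gt0)), (Ordinal d_gt0).
by move=> _ [i _ <-].
Qed.

Let mmin := inf (range mu).

Section large.
Variable n : nat.
Hypothesis ln_n : 1 <= ln (n%:R : R).

Let L := blockLen (d := d) r n.
Let x := xlog n.

Let n_gt0 : (0 < n)%N.
Proof.
by rewrite lt0n; apply/eqP => n0; move: ln_n; rewrite n0 ln0// ler10.
Qed.

Lemma xlog_ge1 : 1 <= xlog n.
Proof. by rewrite /xlog mulr_ege1. Qed.

Let x_gt0 : 0 < x.
Proof. exact: (lt_le_trans ltr01 xlog_ge1). Qed.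

Lemma noise_varE : n%:R `^ (- r) = expR (- x).
Proof. by rewrite /powR pnatr_eq0 gtn_eqF//= mulNr. Qed.

Lemma blockLen_le : L%:R <= x `^ d%:R^-1.
Proof. by rewrite truncn_le powR_ge0. Qed.

Lemma blockLen_gt : x `^ d%:R^-1 < L%:R + 1.
Proof. by rewrite natr1 truncnS_gt. Qed.

Lemma blockLen_gt0 : (0 < L)%N.
Proof.
have : 1 `^ d%:R^-1 <= x `^ d%:R^-1.
  by apply: ge0_ler_powR; rewrite ?nnegrE ?invr_ge0 ?(ltW x_gt0)//; exact: xlog_ge1.
by rewrite powR1 => h; rewrite truncn_ge_nat ?powR_ge0.
Qed.

Lemma blockLen_exp_le : L%:R ^+ d <= x.
Proof.
have dn0 : d%:R != 0 :> R by rewrite pnatr_eq0 -lt0n.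
have xE : (x `^ d%:R^-1) ^+ d = x.
  by rewrite -powR_mulrn ?powR_ge0// -powRrM mulVf// powRr1// ltW.
by rewrite -[leRHS]xE ler_pXn2r ?nnegrE ?powR_ge0//; exact: blockLen_le.
Qed.

Lemma blockLen_exp_ge1 : 1 <= L%:R ^+ d :> R.
Proof. by rewrite -natrX ler1n expn_gt0 blockLen_gt0. Qed.

Let log2L_ge0 : 0 <= log2 (L%:R : R).
Proof.
by rewrite /log2 divr_ge0// ?ln_ge0 ?ler1n ?blockLen_gt0// ltW// ln_gt0// ltr1n.
Qed.

Lemma coarseScale_le : (coarseScale r mu n)%:R <= mmin^-1 * log2 (L%:R : R).
Proof.
rewrite /coarseScale mul1r truncn_le mulr_ge0// invr_ge0 ltW//.
exact: inf_range_gt0.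
Qed.

Lemma maxScale_le : (maxScale r ups mu n)%:R <= r / a * log2 (n%:R : R).
Proof.
have l2 : 0 < ln 2 :> R by rewrite ln_gt0// ltr1n.
rewrite /maxScale truncn_le /log2 mulr_ge0// divr_ge0 ?(ltW l2) ?(ltW a_gt0)//.
  by rewrite (le_trans ler01).
by rewrite (le_trans ler01).
Qed.

Lemma maxScale_gt : r / a * log2 (n%:R : R) < (maxScale r ups mu n)%:R + 1.
Proof. by rewrite natr1 truncnS_gt. Qed.

(** Here exp x = n^r is the inverse noise variance: with this many coefficients up to J_* the
    residual terms n^-r e^-m add up to a multiple of e^-m. *)
Lemma powR_maxScale_le : 2 `^ (a * (maxScale r ups mu n).+1%:R) <= 2 `^ a * expR x.
Proof.
rewrite -[(maxScale _ _ _ _).+1%:R]natr1 mulrDr mulr1 powRD ?pnatr_eq0 ?implybT// mulrC ler_wpM2l ?powR_ge0//.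
have n0 : 0 < n%:R :> R by rewrite ltr0n.
apply: (@le_trans _ _ (2 `^ (r * log2 (n%:R : R)))).
  rewrite ler_powR ?ler1n//; have := ler_wpM2l (ltW a_gt0) maxScale_le.
  by rewrite mulrA [a * (r / a)]mulrC divfK// gt_eqF.
by rewrite powR_log2// /powR gt_eqF.
Qed.

Lemma powR_maxScale_ge (e : R) : 0 < e ->
  2 `^ (- e * (maxScale r ups mu n).+1%:R) <= expR (- (e / a * x)).
Proof.
move=> e0; have n0 : 0 < n%:R :> R by rewrite ltr0n.
apply: (@le_trans _ _ (2 `^ (- (e * (r / a)) * log2 (n%:R : R)))).
  rewrite ler_powR ?ler1n// !mulNr lerN2 -mulrA ler_pM2l// -[(maxScale _ _ _ _).+1%:R]natr1.
  exact: ltW maxScale_gt.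
rewrite powR_log2// /powR gt_eqF//= ler_expR /x /xlog.
rewrite le_eqVlt; apply/orP; left; apply/eqP; ring.
Qed.

(** The coarse scales hold only a power of log n coefficients: 2^j0 <= L^(1/mmin) and L <=
    x^(1/d). *)
Lemma powR_coarseScale_le :
  2 `^ (a * (coarseScale r mu n)%:R) <= x `^ (a / mmin / d%:R).
Proof.
have m0 := inf_range_gt0; have L0 : 0 < L%:R :> R by rewrite ltr0n blockLen_gt0.
apply: (@le_trans _ _ (2 `^ (a / mmin * log2 (L%:R : R)))).
  rewrite ler_powR ?ler1n// -mulrA ler_pM2l//; exact: coarseScale_le.
rewrite powR_log2// [leRHS]powRrM [leRHS]powRAC.
apply: ge0_ler_powR; rewrite ?nnegrE ?powR_ge0 ?ler0n//; last exact: blockLen_le.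
by rewrite divr_ge0 ?(ltW a_gt0)// ltW.
Qed.

End large.

(** The coarsest scale is at most ln x / (mmin d ln 2), while J_* + 1 exceeds x / (a ln 2); it is
    enough that ln x <= (mmin d / a) x. The threshold depends on none of s, p, q, M. *)
Lemma large_sample_eventually : exists n0, forall n, (n0 <= n)%N -> large_sample n.
Proof.
have m0 := inf_range_gt0; have d0 : 0 < d%:R :> R by rewrite ltr0n.
have K0 : 0 < mmin * d%:R / a by rewrite divr_gt0// mulr_gt0.
have [x0 [x00 lnle]] := ln_le_linear K0.
exists (Num.truncn (expR (x0 + 1))).+1 => n n0n.
have nexp : expR (x0 + 1) <= n%:R.
  by apply: (le_trans (ltW (truncnS_gt _))); rewrite ler_nat.
have lnn : x0 + 1 <= ln (n%:R : R).
  by rewrite -[leLHS]expRK ler_ln ?posrE ?expR_gt0// (lt_le_trans _ nexp)// expR_gt0.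
have ln1 : 1 <= ln (n%:R : R) by lra.
split => //; rewrite -ltnS -(ltr_nat R).
have x1 := xlog_ge1 ln1; have xp : 0 < xlog n by rewrite (lt_le_trans ltr01).
have x0x : x0 <= xlog n.
  have : ln n%:R <= xlog n by rewrite /xlog ler_peMl// (le_trans ler01).
  lra.
apply: (le_lt_trans (coarseScale_le ln1)).
have := maxScale_gt n; set J := (maxScale _ _ _ _)%:R => hJ.
suff : mmin^-1 * log2 ((blockLen (d := d) r n)%:R : R) <= r / a * log2 (n%:R : R).
  by rewrite -[_.+2%:R]natr1 -[(maxScale _ _ _ _).+1%:R]natr1; lra.
have l2 : 0 < ln 2 :> R by rewrite ln_gt0// ltr1n.
rewrite /log2 !mulrA ler_pM2r ?invr_gt0//.
rewrite mulrC ler_pdivrMr//.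
have L0 : 0 < (blockLen (d := d) r n)%:R :> R by rewrite ltr0n blockLen_gt0.
apply: (@le_trans _ _ (d%:R^-1 * ln (xlog n))).
  rewrite -ln_powR ler_ln ?posrE ?powR_gt0//; exact: blockLen_le.
rewrite mulrC ler_pdivrMr//; apply: (le_trans (lnle _ x0x)).
by rewrite /xlog le_eqVlt; apply/orP; left; apply/eqP; ring.
Qed.

Lemma level_risk_ge0 n (disp : measure_display) (T : measurableType disp)
  (P : probability T R) (z : coef_family {RV P >-> R} cs ups mu)
  (theta : coef_family R cs ups mu) j :
  (0 <= level_risk lam r n z theta j)%E.
Proof.
have E0 l k : (0 <= 'E_P[fun w => ((estimator lam r n (observation r n theta z w) l k
      - theta j l k) ^+ 2)%R])%E.
  by rewrite unlock; apply: integral_ge0 => w _; rewrite lee_fin sqr_ge0.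
apply: sume_ge0 => l _; rewrite /sumD; case: ifP => _.
  by apply: sume_ge0 => K _; apply: sume_ge0 => k _; exact: E0.
by apply: sume_ge0 => k _; exact: E0.
Qed.

Let t : R := (1 - lam^-1) / 2.
Let K1 : R := t^-1 * Num.sqrt lam.
Let K2 : R := 18 + 2 * lam + 2 * K1.
Let K3 : R := 4 * t^-1.

Let t_gt0 : 0 < t.
Proof. by rewrite divr_gt0// subr_gt0 invf_lt1// (lt_trans _ lam_gt1). Qed.

Let K1_ge0 : 0 <= K1.
Proof. by rewrite mulr_ge0 ?sqrtr_ge0// invr_ge0 ltW. Qed.

Let K2_ge0 : 0 <= K2.
Proof. by rewrite /K2; move: K1_ge0 lam_gt1; lra. Qed.

Let K3_ge0 : 0 <= K3.
Proof. by rewrite mulr_ge0// invr_ge0 ltW. Qed.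

Lemma card_indices_le j (A : nat) : A%:R <= 2 `^ (dstar mu * j%:R) :> R ->
  #|Bset cs ups j|%:R * A%:R <= cs * 2 `^ (a * j%:R).
Proof.
move=> hA; rewrite /a mulrDl powRD ?pnatr_eq0 ?implybT//.
rewrite [2 `^ _ * _]mulrC [leRHS]mulrA; apply: ler_pM => //.
exact: card_Bset_le.
Qed.

(** One bound valid at every j lets the four contributions be summed separately: coarse noise,
    truncated energy, noise excess, energy beyond J_*. The second carries no indicator, being
    nonnegative and summable over all scales. *)
Lemma level_risk_le (s p s' G : R) n (disp : measure_display) (T : measurableType disp)
    (P : probability T R) (z : coef_family {RV P >-> R} cs ups mu)
    (theta : coef_family R cs ups mu) (eta : R) j :
  let c := s * p - (1 - p / 2) * a in
  large_sample n -> 0 <= G ->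
  (forall j (l : Bset cs ups j),
     (j <= lastObserved r ups mu n)%N -> iid_std_normal (z j l)) ->
  n%:R `^ (- r) <= eta ->
  (forall j, blockwise_min r n theta j <= G * eta `^ (1 - p / 2) * 2 `^ (- c * j%:R)) ->
  (forall j, level_energy theta j <= G * 2 `^ (- (2 * s') * j%:R)) ->
  (level_risk lam r n z theta j <=
   (K1 * cs * n%:R `^ (- r) *
      (if (j < coarseScale r mu n)%N then 2 `^ (a * j%:R) else 0)
    + K2 * Num.min (cs * eta * 2 `^ (a * j%:R))
                   (G * eta `^ (1 - p / 2) * 2 `^ (- c * j%:R))
    + K3 * cs * (n%:R `^ (- r) * expR (- (blockLen (d := d) r n)%:R ^+ d)) *
      (if (j < (maxScale r ups mu n).+1)%N then 2 `^ (a * j%:R) else 0)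
    + G * (if ((maxScale r ups mu n).+1 <= j)%N then 2 `^ (- (2 * s') * j%:R) else 0))%:E)%E.
Proof.
move=> /= [ln1 j0J] G0 iidz eta_ge min_le energy_le; set c := _ - _ * a.
have n0 : (0 < n)%N.
  by rewrite lt0n; apply/eqP => n0; move: ln1; rewrite n0 ln0// ler10.
have L0 := blockLen_gt0 ln1.
have iidJ i : (i <= maxScale r ups mu n)%N -> forall l : Bset cs ups i, iid_std_normal (z i l).
  by move=> iJ l; apply: iidz; rewrite leq_max iJ orbT.
have eta0 : 0 <= eta by rewrite (le_trans _ eta_ge) ?powR_ge0.
set U1 := _ * _ * _ * (if _ then _ else _); set U2 := K2 * _.
set U3 := _ * _ * _ * (if _ then _ else _); set U4 := G * (if _ then _ else _).
have ind0 (b : bool) (u : R) : 0 <= (if b then 2 `^ u else 0).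
  by case: b; rewrite ?powR_ge0.
have U10 : 0 <= U1 by rewrite mulr_ge0// mulr_ge0 ?powR_ge0// mulr_ge0.
have U20 : 0 <= U2.
  rewrite mulr_ge0// le_min; apply/andP; split.
    by rewrite mulr_ge0 ?powR_ge0// mulr_ge0.
  by rewrite mulr_ge0 ?powR_ge0// mulr_ge0 ?powR_ge0.
have U30 : 0 <= U3.
  by rewrite mulr_ge0//; apply: mulr_ge0; [rewrite mulr_ge0|rewrite mulr_ge0 ?powR_ge0 ?expR_ge0].
have U40 : 0 <= U4 by rewrite mulr_ge0.
have [jj0|j0j] := ltnP j (coarseScale r mu n).
  have jJ : (j <= maxScale r ups mu n)%N by rewrite -ltnS (leq_trans jj0).
  have := level_risk_coarse theta lam_gt1 n0 jj0 (iidJ _ jJ).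
  move=> /le_trans; apply; rewrite lee_fin -!addrA.
  apply: (@le_trans _ _ U1); last by rewrite lerDl !addr_ge0.
  rewrite /U1 jj0 -/K1.
  apply: (@le_trans _ _ (K1 * (cs * 2 `^ (a * j%:R) * n%:R `^ (- r)))).
    rewrite ler_wpM2l// ler_wpM2r ?powR_ge0//.
    exact: card_indices_le (card_Dset_le mu j).
  rewrite le_eqVlt; apply/orP; left; apply/eqP; ring.
have [jJ|Jj] := leqP j (maxScale r ups mu n); last first.
  have := level_risk_fine lam z theta j0j Jj.
  move=> /le_trans; apply; rewrite lee_fin.
  apply: (le_trans (energy_le j)); apply: (@le_trans _ _ U4).
    by rewrite /U4 Jj.
  by rewrite lerDr !addr_ge0.
have bj : blockScales r ups mu n j by rewrite /blockScales j0j.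
have := level_risk_blocks theta lam_gt1 lam_root n0 L0 bj (iidJ _ jJ).
move=> /le_trans; apply; rewrite lee_fin -/t -/K1 -/K2 -/K3.
apply: (@le_trans _ _ (U2 + U3)); last by move: U10 U40; lra.
apply: lerD.
  rewrite /U2 ler_wpM2l// le_min min_le andbT.
  apply: (le_trans (blockwise_min_le_noise theta cs_ge0 r n j)).
  by rewrite -/a mulrAC ler_wpM2r ?powR_ge0// ler_wpM2l.
rewrite /U3 ltnS jJ.
have hA : #|Aset r mu n j|%:R <= 2 `^ (dstar mu * j%:R) :> R.
  apply: le_trans (card_Aset_le r mu n j).
  by rewrite ler_peMr// blockLen_exp_ge1.
set e := n%:R `^ (- r) * _.
have e0 : 0 <= e by rewrite mulr_ge0 ?powR_ge0 ?expR_ge0.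
apply: (@le_trans _ _ (K3 * (cs * 2 `^ (a * j%:R) * e))).
  by rewrite ler_wpM2l// ler_wpM2r// card_indices_le.
rewrite le_eqVlt; apply/orP; left; apply/eqP; ring.
Qed.

(* [p] and [s'] are the exponents governing the truncated block energies and the scales beyond [J_*]. *)
Lemma risk_le (s p s' G : R) :
  0 < s -> p <= 2 -> 0 < s * p - (1 - p / 2) * a ->
  0 < s' -> s * a <= s' * (2 * s + a) -> 0 <= G ->
  exists C : R, 0 < C /\ forall n, large_sample n ->
  forall (disp : measure_display) (T : measurableType disp) (P : probability T R)
    (z : coef_family {RV P >-> R} cs ups mu),
  (forall j (l : Bset cs ups j),
     (j <= lastObserved r ups mu n)%N -> iid_std_normal (z j l)) ->
  forall (theta : coef_family R cs ups mu) (eta : R),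
  0 < eta -> n%:R `^ (- r) <= eta ->
  (forall j, blockwise_min r n theta j <=
     G * eta `^ (1 - p / 2) * 2 `^ (- (s * p - (1 - p / 2) * a) * j%:R)) ->
  (forall j, level_energy theta j <= G * 2 `^ (- (2 * s') * j%:R)) ->
  (risk lam r n z theta <=
   (C * (expR (- (2 * s / (2 * s + a) * xlog n)) + eta `^ (2 * s / (2 * s + a))))%:E)%E.
Proof.
move=> s0 p2 c0 s'0 ss' G0; set c := s * p - (1 - p / 2) * a in c0 *.
set kappa := 2 * s / (2 * s + a).
have sa0 : 0 < 2 * s + a by rewrite addr_gt0// mulr_gt0.
have k0 : 0 < kappa by rewrite divr_gt0// mulr_gt0.
have k1 : kappa < 1 by rewrite ltr_pdivrMr// mul1r ltrDl.
have k1' : 0 < 1 - kappa by rewrite subr_gt0.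
have dn : 0 < d%:R :> R by rewrite ltr0n.
have da : 0 < 2 `^ a - 1 :> R by rewrite subr_gt0 powR2_gt1.
have dc : 0 < 1 - 2 `^ (- c) :> R by rewrite subr_gt0 powR2_lt1.
have s2' : 0 < 2 * s' by rewrite mulr_gt0.
have ds : 0 < 1 - 2 `^ (- (2 * s')) :> R by rewrite subr_gt0 powR2_lt1.
pose b := a / mmin / d%:R.
have b0 : 0 < b by rewrite !divr_gt0// inf_range_gt0.
pose C1 := K1 * cs * ((b / (1 - kappa)) `^ b / (2 `^ a - 1)).
pose C2 := K2 * (cs / (2 `^ a - 1) + 2 `^ c * G / (1 - 2 `^ (- c))).
pose C3 := K3 * cs * (expR ((d%:R / (1 - kappa)) ^+ d) * (2 `^ a / (2 `^ a - 1))).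
pose C4 := G / (1 - 2 `^ (- (2 * s'))).
have C10 : 0 <= C1.
  by apply: mulr_ge0; [exact: mulr_ge0|rewrite divr_ge0 ?powR_ge0// ltW].
have C20 : 0 <= C2.
  apply: mulr_ge0 => //; apply: addr_ge0; apply: divr_ge0; rewrite ?(ltW da) ?(ltW dc)//.
  by rewrite mulr_ge0 ?powR_ge0.
have C30 : 0 <= C3.
  apply: mulr_ge0; [exact: mulr_ge0|apply: mulr_ge0; first exact: expR_ge0].
  by rewrite divr_ge0 ?powR_ge0// ltW.
have C40 : 0 <= C4 by rewrite divr_ge0// ltW.
exists (C1 + C2 + C3 + C4 + 1); split.
  by rewrite ltr_wpDl// !addr_ge0.
move=> n large disp T P z iidz theta eta eta0 eta_ge min_le energy_le.
have [ln1 j0J] := large.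
have x1 := xlog_ge1 ln1; have x0 : 0 < xlog n by rewrite (lt_le_trans ltr01).
set x := xlog n in x1 x0 *.
have lvl j := level_risk_le j large G0 iidz eta_ge min_le energy_le.
have E0 : 0 <= expR (- (kappa * x)) by exact: expR_ge0.
have H0 : 0 <= eta `^ kappa by exact: powR_ge0.
have epsE := noise_varE ln1; rewrite -/x in epsE.
(* Level risks are nonnegative, so a bound uniform in N passes to the series. *)
suff partial N : (\sum_(0 <= j < N) level_risk lam r n z theta j <=
    (C1 * expR (- (kappa * x)) + C2 * eta `^ kappa + C3 * expR (- (kappa * x))
     + C4 * expR (- (kappa * x)))%:E)%E.
  apply: (@le_trans _ _ (C1 * expR (- (kappa * x)) + C2 * eta `^ kappa
     + C3 * expR (- (kappa * x)) + C4 * expR (- (kappa * x)))%:E).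
    apply: lime_le; last by apply: nearW => N; exact: partial.
    by apply: is_cvg_nneseries => j _ _; exact: level_risk_ge0.
  rewrite lee_fin.
  have := mulr_ge0 C10 H0; have := mulr_ge0 C20 E0; have := mulr_ge0 C30 H0.
  have := mulr_ge0 C40 H0; lra.
rewrite big_mkord; apply: (le_trans (lee_sum _ (fun j _ => lvl (j : 'I_N)))).
rewrite sumEFin lee_fin !big_split/= -!mulr_sumr; apply: lerD; [apply: lerD; [apply: lerD|]|].
(* Coarse noise: the factor x^b is absorbed by exp((1 - kappa) x), since kappa < 1. *)
- rewrite epsE; set S1 := \sum_(j < N) _.
  have hS : S1 <= (b / (1 - kappa)) `^ b * expR ((1 - kappa) * x) / (2 `^ a - 1).
    apply: (le_trans (geometric_sum_below _ _ a_gt0)).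
    rewrite ler_wpM2r ?invr_ge0 ?(ltW da)//.
    exact: le_trans (powR_coarseScale_le ln1) (powR_le_expR b0 k1' x0).
  have := ler_wpM2l (mulr_ge0 (mulr_ge0 K1_ge0 cs_ge0) (expR_ge0 (- x))) hS.
  move=> /le_trans; apply.
  rewrite (_ : expR (- (kappa * x)) = expR (- x) * expR ((1 - kappa) * x)); last first.
    by rewrite -expRD; congr expR; ring.
  rewrite /C1 le_eqVlt; apply/orP; left; apply/eqP; ring.
- by rewrite /C2 -[leRHS]mulrA ler_wpM2l//; exact: sum_min_rate.
(* Noise excess: exp x coefficients cancel the variance exp(-x), and e^(-L^d) remains. *)
- rewrite epsE; set e := expR (- _ ^+ d); set S3 := \sum_(j < N) _.
  have h1 : e <= expR ((d%:R / (1 - kappa)) ^+ d) * expR (- (kappa * x)).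
    by apply: expR_block_length => //; apply: ltW; exact: blockLen_gt.
  have hS : S3 <= 2 `^ a * expR x / (2 `^ a - 1).
    apply: (le_trans (geometric_sum_below _ _ a_gt0)).
    by rewrite ler_wpM2r ?invr_ge0 ?(ltW da)//; exact: powR_maxScale_le.
  have e0 : 0 <= e by exact: expR_ge0.
  have := ler_wpM2l (mulr_ge0 (mulr_ge0 K3_ge0 cs_ge0) (mulr_ge0 (expR_ge0 (- x)) e0)) hS.
  move=> /le_trans; apply.
  rewrite (_ : K3 * cs * _ * _ = K3 * cs * (2 `^ a / (2 `^ a - 1)) * e * (expR (- x) * expR x)); last by ring.
  rewrite -expRD addNr expR0 mulr1.
  have Q0 : 0 <= K3 * cs * (2 `^ a / (2 `^ a - 1)).
    by apply: mulr_ge0; [exact: mulr_ge0|rewrite divr_ge0 ?powR_ge0// ltW].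
  apply: (le_trans (ler_wpM2l Q0 h1)).
  rewrite /C3 le_eqVlt; apply/orP; left; apply/eqP; ring.
(* Energy beyond J_* is of order exp(-(2s'/a) x); the hypothesis on s' says exactly 2s'/a >=
   kappa. *)
- rewrite /C4 -[leRHS]mulrA ler_wpM2l//.
  apply: (le_trans (geometric_sum_above _ _ s2')).
  rewrite mulrC ler_wpM2l ?invr_ge0 ?(ltW ds)//.
  apply: (le_trans (powR_maxScale_ge ln1 s2')); rewrite ler_expR lerN2 -/x.
  rewrite ler_wpM2r ?(ltW x0)// /kappa ler_pdivrMr// mulrAC ler_pdivlMr//.
  by rewrite -!mulrA ler_pM2l.
Qed.

End total_risk.

(** * The two rates *)

Section rates.
Context {R : realType} {d : nat} (d_gt0 : (0 < d)%N).
Context (r cs ups lam : R) (mu : 'I_d -> R).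
Hypothesis r_ge1 : 1 <= r.
Hypothesis cs_ge0 : 0 <= cs.
Hypothesis ups_ge0 : 0 <= ups.
Hypothesis mu_gt0 : forall i, 0 < mu i.
Hypothesis lam_gt1 : 1 < lam.
Hypothesis lam_root : lam - ln lam = 3.
Context (s M : R) (p q : \bar R).
Hypothesis s_gt0 : 0 < s.
Hypothesis M_gt0 : 0 < M.
Hypothesis p_gt0 : (0 < p)%E.
Hypothesis q_gt0 : (0 < q)%E.

Let D := dstar mu.
Let a := D + ups.
Let kappa := 2 * s / (2 * s + a).

Let D_gt0 : 0 < D. Proof. exact: dstar_gt0. Qed.

Let a_gt0 : 0 < a. Proof. by rewrite ltr_pwDl. Qed.

Let sa_gt0 : 0 < 2 * s + a. Proof. by rewrite addr_gt0// mulr_gt0. Qed.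

Let kappa_gt0 : 0 < kappa. Proof. by rewrite divr_gt0// mulr_gt0. Qed.

Let kappa_lt1 : kappa < 1. Proof. by rewrite ltr_pdivrMr// mul1r ltrDl. Qed.

Let n_gt0 n : 1 <= ln (n%:R : R) -> 0 < n%:R :> R.
Proof.
move=> ln1; rewrite ltr0n lt0n; apply/eqP => n0.
by move: ln1; rewrite n0 ln0// ler10.
Qed.

Let exponentE : 2 * s * r / (2 * s + dstar mu + ups) = kappa * r.
Proof. by rewrite /kappa /a /D addrA; ring. Qed.

Lemma rateE n : 1 <= ln (n%:R : R) ->
  rate s r ups mu n = expR (- (kappa * (r * ln n%:R))).
Proof.
move=> /n_gt0 n0; rewrite /rate exponentE /powR gt_eqF//; congr expR; ring.
Qed.

Lemma rate_logE n : 1 <= ln (n%:R : R) ->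
  rate_log s r ups mu n =
  ln (n%:R : R) `^ (kappa * r) * expR (- (kappa * (r * ln n%:R))).
Proof.
move=> ln1; have n0 := n_gt0 ln1; have l0 : 0 < ln (n%:R : R) by rewrite (lt_le_trans ltr01).
rewrite /rate_log exponentE powRM ?invr_ge0 ?(ltW l0) ?(ltW n0)//; congr (_ * _).
rewrite /powR invr_eq0 gt_eqF// lnV ?posrE//; congr expR; ring.
Qed.

(** With capped exponent 2 the factor eta^(1 - p/2) is 1, so the level energy bounds the block
    minima and eta can be the noise variance itself, without logarithm. *)
Lemma risk_le_rate : (2%:E <= p)%E -> (q <= 2%:E)%E \/ ups = 0 ->
  exists C : R, 0 < C /\ forall n, large_sample r ups mu n ->
  forall (disp : measure_display) (T : measurableType disp) (P : probability T R)
    (z : coef_family {RV P >-> R} cs ups mu),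
  (forall j (l : Bset cs ups j),
     (j <= lastObserved r ups mu n)%N -> iid_std_normal (z j l)) ->
  forall theta, smoothness_ball s p q M theta ->
  (risk lam r n z theta <= (C * rate s r ups mu n)%:E)%E.
Proof.
move=> p2 qe; pose G := 2 * (1 + cs) * M ^+ 2.
have G0 : 0 <= G by rewrite mulr_ge0 ?sqr_ge0// mulr_ge0// addr_ge0.
have cE : s * 2 - (1 - 2 / 2) * a = 2 * s by rewrite divff ?pnatr_eq0//; ring.
have c0 : 0 < s * 2 - (1 - 2 / 2) * a by rewrite cE mulr_gt0.
have ss : s * a <= s * (2 * s + a) by rewrite ler_pM2l// lerDr mulr_ge0// ltW.
have [C [C0 riskC]] := risk_le d_gt0 r_ge1 cs_ge0 ups_ge0 mu_gt0 lam_gt1 lam_root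
  s_gt0 (lexx 2) c0 s_gt0 ss G0.
exists (2 * C); split; first by rewrite mulr_gt0.
move=> n large disp T P z iidz theta th; have [ln1 _] := large.
have eps0 : 0 < n%:R `^ (- r) by rewrite powR_gt0// n_gt0.
have energy j := level_energy_ge2 cs_ge0 M_gt0 p_gt0 q_gt0 th j p2 qe.
have := riskC n large disp T P z iidz theta _ eps0 (lexx _).
rewrite cE divff ?pnatr_eq0// subrr powRr0 mulr1 => /(_ _ energy).
have block j : blockwise_min r n theta j <= G * 2 `^ (- (2 * s) * j%:R).
  exact: le_trans (blockwise_min_le_energy theta r n j) (energy j).
move=> /(_ block) /le_trans; apply; rewrite lee_fin rateE//.
rewrite -/D -/a -/kappa (noise_varE r ln1).
rewrite (_ : expR (- (r * _)) `^ kappa = expR (- (kappa * (r * ln n%:R)))).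
  by rewrite le_eqVlt; apply/orP; left; apply/eqP; ring.
by rewrite /powR expR_eq0 expRK; congr expR; ring.
Qed.

(** Here eta = L^d n^-r is the noise energy of a block; L^d <= r log n is the source of the
    logarithm in the rate. *)
Lemma risk_le_rate_log : (p < 2%:E)%E -> (q <= p)%E \/ ups = 0 ->
  Num.max D ((1 - fine p / 2) * a) < s * fine p ->
  exists C : R, 0 < C /\ forall n, large_sample r ups mu n ->
  forall (disp : measure_display) (T : measurableType disp) (P : probability T R)
    (z : coef_family {RV P >-> R} cs ups mu),
  (forall j (l : Bset cs ups j),
     (j <= lastObserved r ups mu n)%N -> iid_std_normal (z j l)) ->
  forall theta, smoothness_ball s p q M theta ->
  (risk lam r n z theta <= (C * rate_log s r ups mu n)%:E)%E.
Proof.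
move=> p2 qe; rewrite gt_max => /andP[spD spa].
have [p' pE] : exists p', p = p'%:E.
  by case: p p_gt0 p2 => [p'| |]//; exists p'.
have p'0 : 0 < p' by rewrite -lte_fin -pE.
have p'2 : p' < 2 by rewrite -lte_fin -pE.
have q2 : (q <= 2%:E)%E \/ ups = 0.
  by case: qe => [qp|]; [left; apply: (le_trans qp); exact: ltW|right].
rewrite pE/= in spD spa.
pose G := 2 * (1 + cs) * M ^+ 2 + (1 + cs) * M `^ p'.
have cs1 : 0 <= 1 + cs by rewrite addr_ge0.
have G1 : 0 <= 2 * (1 + cs) * M ^+ 2 by rewrite mulr_ge0 ?sqr_ge0// mulr_ge0.
have G2 : 0 <= (1 + cs) * M `^ p' by rewrite mulr_ge0 ?powR_ge0.
have G0 : 0 <= G by rewrite addr_ge0.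
have c0 : 0 < s * p' - (1 - p' / 2) * a by rewrite subr_gt0.
pose v := p'^-1; have v0 : 0 < v by rewrite invr_gt0.
have pv : p' * v = 1 by rewrite /v divff// gt_eqF.
have sD : D * v < s by have := spD; rewrite -(ltr_pM2r v0) -mulrA pv mulr1.
have sa : (v - 2^-1) * a < s.
  have := spa; rewrite -(ltr_pM2r v0) -[X in _ < X]mulrA pv mulr1.
  rewrite (_ : (1 - p' / 2) * a * v = (v - 2^-1 * (p' * v)) * a); last by ring.
  by rewrite pv mulr1.
have v2 : 2^-1 < v by rewrite /v ltf_pV2 ?posrE.
pose s' := s + D / 2 - D / p'.
have s'v : s' = s + D / 2 - D * v by [].
have s'0 : 0 < s' by rewrite s'v; have : 0 < D / 2; [rewrite divr_gt0|lra].
(* With v = 1/p', the difference is 2ss' - Da(v - 1/2). The condition s > Dv gives 2s' > D, and s >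
   (v - 1/2) a bounds the other factor; their product is the claim. *)
have ss' : s * a <= s' * (2 * s + a).
  have h : D * (2 * (v - 2^-1) * a) <= (2 * s' ) * (2 * s).
    apply: ler_pM; rewrite ?(ltW D_gt0)//.
    - by rewrite mulr_ge0 ?(ltW a_gt0)// mulr_ge0// subr_ge0 ltW.
    - rewrite s'v; lra.
    - lra.
  rewrite -subr_ge0 (_ : _ - _ = ((2 * s') * (2 * s) - D * (2 * (v - 2^-1) * a)) / 2).
    by rewrite divr_ge0// subr_ge0.
  by rewrite s'v; field.
have [C [C0 riskC]] := risk_le d_gt0 r_ge1 cs_ge0 ups_ge0 mu_gt0 lam_gt1 lam_root
  s_gt0 (ltW p'2) c0 s'0 ss' G0.
exists (C * (1 + r)); split; first by rewrite mulr_gt0// ltr_pwDl// (le_trans ler01).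
move=> n large disp T P z iidz theta th; have [ln1 _] := large.
have n0 := n_gt0 ln1; have l0 : 0 < ln (n%:R : R) by rewrite (lt_le_trans ltr01).
have eps0 : 0 < n%:R `^ (- r) by rewrite powR_gt0.
set L := blockLen (d := d) r n.
have L0 : (0 < L)%N := blockLen_gt0 r_ge1 ln1.
pose eta := L%:R ^+ d * n%:R `^ (- r).
have Ld1 : 1 <= L%:R ^+ d :> R := blockLen_exp_ge1 r_ge1 ln1.
have Ldx : L%:R ^+ d <= r * ln n%:R := blockLen_exp_le d_gt0 r_ge1 ln1.
have eps_eta : n%:R `^ (- r) <= eta by rewrite /eta ler_peMl// ltW.
have eta0 : 0 < eta by rewrite (lt_le_trans eps0).
have energy j : level_energy theta j <= G * 2 `^ (- (2 * s') * j%:R).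
  apply: (le_trans (level_energy_lt2 cs_ge0 M_gt0 p_gt0 q_gt0 th j pE p'2 q2)).
  by rewrite ler_wpM2r ?powR_ge0// lerDl.
have block j : blockwise_min r n theta j <=
    G * eta `^ (1 - p' / 2) * 2 `^ (- (s * p' - (1 - p' / 2) * a) * j%:R).
  have n0' : (0 < n)%N by rewrite -(ltr0n R).
  apply: (le_trans (blockwise_min_lt2 cs_ge0 M_gt0 p_gt0 q_gt0 th j pE p'2 qe L0 n0')).
  rewrite -[leRHS]mulrA; apply: ler_pM => //.
  - by rewrite lerDr.
  (* The available decay exponent exceeds the required one by (1 - p'/2) ups. *)
  rewrite ler_wpM2l ?powR_ge0// ler_powR ?ler1n// ler_wpM2r// lerN2.
  have : 0 <= (1 - p' / 2) * ups.
    by rewrite mulr_ge0// subr_ge0 ler_pdivrMr// mul1r ltW.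
  by rewrite /a -/D; lra.
have := riskC n large disp T P z iidz theta eta eta0 eps_eta block energy.
move=> /le_trans; apply; rewrite lee_fin rate_logE//.
rewrite -/D -/a -/kappa.
set E := expR (- (kappa * (r * ln n%:R))); have E0 : 0 < E by exact: expR_gt0.
have kr : 0 <= kappa * r by rewrite mulr_ge0// ?(ltW kappa_gt0)// (le_trans ler01).
have l1 : 1 <= ln (n%:R : R) `^ (kappa * r).
  have : 1 `^ (kappa * r) <= ln (n%:R : R) `^ (kappa * r).
    by apply: ge0_ler_powR; rewrite ?nnegrE ?(ltW l0).
  by rewrite powR1.
have r0 : 0 <= r by rewrite (le_trans ler01).
(* As r >= 1 and log n >= 1, r^kappa <= r and (log n)^kappa is at most (log n)^(kappa r), the power
   present in the rate. *)
have etak : eta `^ kappa <= r * (ln (n%:R : R) `^ (kappa * r) * E).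
  apply: (@le_trans _ _ ((r * ln n%:R * expR (- (r * ln n%:R))) `^ kappa)).
    apply: ge0_ler_powR; rewrite ?nnegrE ?(ltW kappa_gt0) ?(ltW eta0)//.
      by rewrite mulr_ge0 ?expR_ge0// mulr_ge0// ltW.
    by rewrite /eta (noise_varE r ln1) ler_wpM2r ?expR_ge0.
  rewrite powRM ?expR_ge0 ?mulr_ge0 ?(ltW l0)// powRM ?(ltW l0)//.
  have -> : expR (- (r * ln n%:R)) `^ kappa = E.
    by rewrite /powR expR_eq0 expRK /E; congr expR; ring.
  rewrite -mulrA; apply: ler_pM; rewrite ?powR_ge0//.
  - by rewrite mulr_ge0 ?powR_ge0 ?(ltW E0).
  - by apply: ler1_powR => //; exact: ltW.
  rewrite ler_wpM2r ?(ltW E0)// ler_powR//.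
  by rewrite ler_peMr// ltW.
rewrite -mulrA ler_wpM2l ?(ltW C0)// mulrDl mul1r; apply: lerD => //.
by rewrite ler_peMl// ltW.
Qed.

End rates.

(** * Uniform risk bounds over smoothness balls *)

Theorem proposition3p2 (R : realType) (d : nat) (hd : (0 < d)%N)
  (r cs ups lam : R) (mu : 'I_d -> R)
  (hr : 1 <= r <= d%:R) (hcs : 1 <= cs) (hups : 0 <= ups <= 1)
  (hmu : forall i, 0 < mu i)
  (hlam : lam - ln lam = 3)
  (hlam_num : 4 + 505 / 10 ^+ 3 + 24 / 10 ^+ 5 <= lam
                < 4 + 505 / 10 ^+ 3 + 25 / 10 ^+ 5) :
  exists n0 : nat,
  forall (s : R) (p q : \bar R) (M : R),
  0 < s -> (0 < p)%E -> (0 < q)%E -> 0 < M ->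
  exists C : R, 0 < C /\
  forall (n : nat), (n0 <= n)%N ->
  forall (disp : measure_display) (T : measurableType disp)
    (P : probability T R) (z : coef_family {RV P >-> R} cs ups mu),
  (forall (j : nat) (l : Bset cs ups j),
     (j <= lastObserved r ups mu n)%N -> iid_std_normal (z j l)) ->
  let max_risk := ereal_sup
    [set risk lam r n z theta | theta in smoothness_ball s p q M] in
  [/\ (q <= 2%:E)%E && (2%:E <= p)%E ->
        (max_risk <= (C * rate s r ups mu n)%:E)%E,
      (q <= p)%E && (p < 2%:E)%E ->
        s * fine p > Num.max (dstar mu) ((1 - fine p / 2) * (dstar mu + ups)) ->
        (max_risk <= (C * rate_log s r ups mu n)%:E)%E,
      ups = 0 -> (2%:E <= p)%E ->
        (max_risk <= (C * rate s r ups mu n)%:E)%E &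
      ups = 0 -> (p < 2%:E)%E ->
        s * fine p > Num.max (dstar mu) ((1 - fine p / 2) * dstar mu) ->
        (max_risk <= (C * rate_log s r ups mu n)%:E)%E].
Proof.
have /andP[r1 _] := hr; have /andP[ups0 _] := hups.
have cs0 : 0 <= cs by rewrite (le_trans ler01).
(* x - ln x = 3 also has a root in ]0, 1[; the numerical enclosure selects the larger one, for which
   t = (1 - 1/lam)/2 is positive. *)
have lam1 : 1 < lam.
  have u0 := divr_ge0 (ler0n R 505) (exprn_ge0 3 (ler0n R 10)).
  have v0 := divr_ge0 (ler0n R 24) (exprn_ge0 5 (ler0n R 10)).
  move: hlam_num u0 v0 => /andP[+ _].
  by move: (505 / _) (24 / _) => u v; lra.
have [n0 large] := large_sample_eventually hd r1 ups0 hmu.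
exists n0 => s p q M s0 p0 q0 M0.
pose D := Num.max (dstar mu) ((1 - fine p / 2) * (dstar mu + ups)) < s * fine p.
(* The constant must precede n and serve all four claims: each regime gets its own, with default 1
   when its conditions fail, and the sum is used. *)
have [C1 [C10 hC1]] : exists C : R, 0 < C /\
    ((2%:E <= p)%E -> (q <= 2%:E)%E \/ ups = 0 ->
     forall n, (n0 <= n)%N ->
     forall (disp : measure_display) (T : measurableType disp) (P : probability T R)
       (z : coef_family {RV P >-> R} cs ups mu),
     (forall j (l : Bset cs ups j),
        (j <= lastObserved r ups mu n)%N -> iid_std_normal (z j l)) ->
     forall theta, smoothness_ball s p q M theta ->
     (risk lam r n z theta <= (C * rate s r ups mu n)%:E)%E).
  have [[p2 qe]|no] := pselect ((2%:E <= p)%E /\ ((q <= 2%:E)%E \/ ups = 0)).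
    have [C [C0 hC]] := risk_le_rate hd r1 cs0 ups0 hmu lam1 hlam s0 M0 p0 q0 p2 qe.
    by exists C; split => // _ _ n /large; exact: hC.
  by exists 1; split => // p2 qe; case: no.
have [C2 [C20 hC2]] : exists C : R, 0 < C /\
    ((p < 2%:E)%E -> (q <= p)%E \/ ups = 0 -> D ->
     forall n, (n0 <= n)%N ->
     forall (disp : measure_display) (T : measurableType disp) (P : probability T R)
       (z : coef_family {RV P >-> R} cs ups mu),
     (forall j (l : Bset cs ups j),
        (j <= lastObserved r ups mu n)%N -> iid_std_normal (z j l)) ->
     forall theta, smoothness_ball s p q M theta ->
     (risk lam r n z theta <= (C * rate_log s r ups mu n)%:E)%E).
  have [[[p2 qe] sp]|no] := pselect (((p < 2%:E)%E /\ ((q <= p)%E \/ ups = 0)) /\ D).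
    have [C [C0 hC]] := risk_le_rate_log hd r1 cs0 ups0 hmu lam1 hlam s0 M0 p0 q0 p2 qe sp.
    by exists C; split => // _ _ _ n /large; exact: hC.
  by exists 1; split => // p2 qe sp; case: no.
exists (C1 + C2); split; first by rewrite addr_gt0.
move=> n n0n disp T P z iidz max_risk.
have bound1 : (2%:E <= p)%E -> (q <= 2%:E)%E \/ ups = 0 ->
    (max_risk <= ((C1 + C2) * rate s r ups mu n)%:E)%E.
  move=> p2 qe; apply: ge_ereal_sup => _ [theta th <-].
  apply: (le_trans (hC1 p2 qe n n0n disp T P z iidz theta th)).
  by rewrite lee_fin ler_wpM2r ?powR_ge0// lerDl ltW.
have bound2 : (p < 2%:E)%E -> (q <= p)%E \/ ups = 0 -> D ->
    (max_risk <= ((C1 + C2) * rate_log s r ups mu n)%:E)%E.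
  move=> p2 qe sp; apply: ge_ereal_sup => _ [theta th <-].
  apply: (le_trans (hC2 p2 qe sp n n0n disp T P z iidz theta th)).
  by rewrite lee_fin ler_wpM2r ?powR_ge0// lerDr ltW.
split.
- by move=> /andP[q2 p2]; apply: bound1 => //; left.
- by move=> /andP[qp p2] sp; apply: bound2 => //; left.
- by move=> u0 p2; apply: bound1 => //; right.
- by move=> u0 p2 sp; apply: bound2 => //; [right|rewrite /D u0 addr0].
Qed.
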